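(* For every simplicial set $X$, the canonical map $j_X : X \to \mathrm{Ex}^\infty X$ is a strong anodyne extension.
   Context: $\mathsf{sSet}$ is the category of simplicial sets, $\triangle^n$ the standard $n$-simplex, $\Lambda^n_k \hookrightarrow \triangle^n$ ($n\ge 1$, $0\le k\le n$) the horn inclusions. Strong anodyne extension: let $m : A \hookrightarrow B$ be a monomorphism in $\mathsf{sSet}$ (identify $A$ with its image). An anodyne presentation for $m$ consists of an ordinal $\kappa$ and an increasing family of subcomplexes $(A^\alpha)_{\alpha\le\kappa}$ of $B$ such that: $A^0 = A$ and $A^\kappa = B$; for every non-zero limit ordinal $\lambda\le\kappa$, $\bigcup_{\alpha<\lambda}A^\alpha = A^\lambda$; for every $\alpha<\kappa$ the inclusion $A^\alpha\hookrightarrow A^{\alpha+1}$ is a pushout of a coproduct of horn inclusions. The map $m$ is a strong anodyne extension if it admits an anodyne presentation. (No closure under retracts.) Subdivision and extension: $\mathrm{sd}\,\triangle^n$ is the nerve of the poset of non-empty subsets of $\{0,1,\ldots,n\}$ ordered by inclusion (functorial in $[n]\in\Delta$ by direct image), and $\mathrm{sd}:\mathsf{sSet}\to\mathsf{sSet}$ is its left Kan extension along the Yoneda embedding. Its right adjoint $\mathrm{Ex}$ is $(\mathrm{Ex}\,X)_n = \mathsf{sSet}(\mathrm{sd}\,\triangle^n, X)$. The last-vertex map $\bar\jmath_n : \mathrm{sd}\,\triangle^n\to\triangle^n$ is the nerve of the poset map $\sigma\mapsto\max\sigma$. The natural map $j_X : X\to\mathrm{Ex}\,X$ sends an $n$-simplex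 $\sigma:\triangle^n\to X$ to $\sigma\circ\bar\jmath_n$. $\mathrm{Ex}^\infty X$ is the colimit of the sequence $X\xrightarrow{j_X}\mathrm{Ex}\,X\xrightarrow{j_{\mathrm{Ex} X}}\mathrm{Ex}(\mathrm{Ex}\,X)\to\cdots$, and the colimit coprojection $X\to\mathrm{Ex}^\infty X$ is also denoted $j_X$. *)

(* Defs.v *)
From HB Require Import structures.
From Stdlib Require Import Relation_Operators.
From mathcomp Require Import all_boot all_order.
From mathcomp Require Import boolp classical_sets wochoice.

Set Implicit Arguments.
Unset Strict Implicit.
Unset Printing Implicit Defensive.

Import Order.TTheory.

Local Open Scope classical_set_scope.

Lemma omorph_eq d (P : porderType d) d' (Q : porderType d')
  (f g : {omorphism P -> Q}) : f =1 g -> f = g.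
Proof.
case: f g => [f [[hf]]] [g [[hg]]] /= fg.
have {}fg : f = g by apply/funext.
by case: _ / fg in hg *; rewrite (Prop_irrelevance hf hg).
Qed.

Definition omorph_id d (P : porderType d) : {omorphism P -> P} := idfun.

Definition omorph_comp d (P : porderType d) d' (Q : porderType d')
  d'' (S : porderType d'') (g : {omorphism Q -> S}) (f : {omorphism P -> Q}) :
  {omorphism P -> S} := g \o f.

(* The morphisms [m] -> [n] of the simplex category, [n] being 'I_n.+1 with   *)
(* its usual order.                                                           *)
Notation Delta m n := {omorphism 'I_m.+1 -> 'I_n.+1}.

Record sset := SSet {
  simp :> nat -> Type;
  act : forall m n, Delta m n -> simp n -> simp m;
  act_id : forall n (x : simp n), act (omorph_id _) x = x;
  act_comp : forall l m n (g : Delta m n) (f : Delta l m) (x : simp n),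
    act (omorph_comp g f) x = act f (act g x) }.

Record hom (X Y : sset) := Hom {
  app :> forall n, X n -> Y n;
  app_act : forall m n (f : Delta m n) (x : X n),
    app (act f x) = act f (app x) }.

Lemma hom_eq (X Y : sset) (f g : hom X Y) :
  (forall n (x : X n), f n x = g n x) -> f = g.
Proof.
case: f g => [f hf] [g hg] /= fg.
have {}fg : f = g by apply: functional_extensionality_dep => n; apply/funext.
by case: _ / fg in hg *; rewrite (Prop_irrelevance hf hg).
Qed.

Definition hom_id (X : sset) : hom X X :=
  @Hom X X (fun _ x => x) (fun _ _ _ _ => erefl).

Lemma hom_comp_subproof (X Y Z : sset) (g : hom Y Z) (f : hom X Y) m n
  (s : Delta m n) (x : X n) : g m (f m (act s x)) = act s (g n (f n x)).
Proof. by rewrite !app_act. Qed.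

Definition hom_comp (X Y Z : sset) (g : hom Y Z) (f : hom X Y) : hom X Z :=
  Hom (hom_comp_subproof g f).

Definition monic (A B : sset) (m : hom A B) : Prop :=
  forall (Z : sset) (f g : hom Z A), hom_comp m f = hom_comp m g -> f = g.

Lemma nerve_id d (P : porderType d) n (x : {omorphism 'I_n.+1 -> P}) :
  omorph_comp x (omorph_id _) = x.
Proof. exact: omorph_eq. Qed.

Lemma nerve_comp d (P : porderType d) l m n (g : Delta m n) (f : Delta l m)
  (x : {omorphism 'I_n.+1 -> P}) :
  omorph_comp x (omorph_comp g f) = omorph_comp (omorph_comp x g) f.
Proof. exact: omorph_eq. Qed.

Definition nerve d (P : porderType d) : sset :=
  @SSet (fun n => {omorphism 'I_n.+1 -> P})
    (fun m n f x => omorph_comp x f) (@nerve_id _ P) (@nerve_comp _ P).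

Lemma nerve_map_subproof d (P : porderType d) d' (Q : porderType d')
  (h : {omorphism P -> Q}) m n (f : Delta m n) (x : nerve P n) :
  omorph_comp h (act f x) = act f (omorph_comp h x : nerve Q n).
Proof. exact: omorph_eq. Qed.

Definition nerve_map d (P : porderType d) d' (Q : porderType d')
  (h : {omorphism P -> Q}) : hom (nerve P) (nerve Q) :=
  @Hom (nerve P) (nerve Q) (fun n x => omorph_comp h x)
    (@nerve_map_subproof _ P _ Q h).

Definition simplex n : sset := nerve 'I_n.+1.

Lemma yoneda_subproof (X : sset) n (x : X n) k l (f : Delta k l)
  (s : simplex n l) : act (act f s : Delta k n) x = act f (act s x).
Proof. exact: act_comp. Qed.

Definition yoneda (X : sset) n (x : X n) : hom (simplex n) X :=
  @Hom (simplex n) X (fun m s => act s x) (@yoneda_subproof X n x).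

Lemma monicP (A B : sset) (m : hom A B) :
  monic m <-> forall n, injective (m n).
Proof.
split=> [mm n x y mxy|mi Z f g fg]; last first.
  by apply: hom_eq => n x; apply: mi; exact: (congr1 (fun h => app h x) fg).
have : yoneda x = yoneda y.
  by apply: mm; apply: hom_eq => k s /=; rewrite !app_act mxy.
move/(congr1 (fun h => app h (omorph_id _ : simplex n n))) => /=.
by rewrite !act_id.
Qed.

Record subcomplex (B : sset) := Subcomplex {
  sub_simp :> forall n, set (B n);
  sub_act : forall m n (f : Delta m n) (x : B n),
    sub_simp x -> sub_simp (act f x) }.

Definition sub_le (B : sset) (S T : subcomplex B) : Prop :=
  forall n, S n `<=` T n.

Section SubcomplexSSet.
Variables (B : sset) (S : subcomplex B).

Definition sub_restr m n (f : Delta m n) (x : S n) : S m :=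
  SigSub (mem_set (sub_act f (set_mem (valP x)))).

Lemma sub_restr_id n (x : S n) : sub_restr (omorph_id _) x = x.
Proof. by apply: val_inj; exact: act_id. Qed.

Lemma sub_restr_comp l m n (g : Delta m n) (f : Delta l m) (x : S n) :
  sub_restr (omorph_comp g f) x = sub_restr f (sub_restr g x).
Proof. by apply: val_inj; exact: act_comp. Qed.

Definition sub_sset : sset :=
  @SSet (fun n => set_type (S n)) sub_restr sub_restr_id sub_restr_comp.

Definition sub_emb : hom sub_sset B :=
  @Hom sub_sset B (fun n x => val x) (fun _ _ _ _ => erefl).

End SubcomplexSSet.

Section SubcomplexInclusion.
Variables (B : sset) (S T : subcomplex B) (ST : sub_le S T).

Definition sub_widen n (x : sub_sset S n) : sub_sset T n :=
  SigSub (mem_set (ST (set_mem (valP x)))).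

Lemma sub_widen_act m n (f : Delta m n) (x : sub_sset S n) :
  sub_widen (act f x) = act f (sub_widen x).
Proof. exact: val_inj. Qed.

Definition sub_incl : hom (sub_sset S) (sub_sset T) := Hom sub_widen_act.

End SubcomplexInclusion.

Lemma horn_act n (k : 'I_n.+1) m l (f : Delta m l) (s : simplex n l) :
  (exists2 i, i != k & forall a, s a != i) ->
  exists2 i, i != k & forall a, (act f s : simplex n m) a != i.
Proof. by case=> i ik si; exists i => // a; exact: si. Qed.

(* A simplex [m] -> [n] lies in the horn when it lies in some face other than *)
(* the k-th, i.e. when it misses some vertex i != k.                          *)
Definition horn n (k : 'I_n.+1) : subcomplex (simplex n) :=
  @Subcomplex (simplex n)
    (fun m => [set s : simplex n m | exists2 i, i != k & forall a, s a != i])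
    (@horn_act n k).

Section Coproduct.
Variables (I : Type) (X : I -> sset).

Definition coprod_act m n (f : Delta m n) (p : {i : I & X i n}) :
  {i : I & X i m} := existT _ (projT1 p) (act f (projT2 p)).

Lemma coprod_act_id n (p : {i : I & X i n}) : coprod_act (omorph_id _) p = p.
Proof. by case: p => i x; rewrite /coprod_act act_id. Qed.

Lemma coprod_act_comp l m n (g : Delta m n) (f : Delta l m)
  (p : {i : I & X i n}) :
  coprod_act (omorph_comp g f) p = coprod_act f (coprod_act g p).
Proof. by rewrite /coprod_act act_comp. Qed.

Definition coprod : sset :=
  @SSet (fun n => {i : I & X i n}) coprod_act coprod_act_id coprod_act_comp.

End Coproduct.

Section CoproductMap.
Variables (I : Type) (X Y : I -> sset) (h : forall i, hom (X i) (Y i)).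

Definition coprod_map_app n (p : coprod X n) : coprod Y n :=
  existT _ (projT1 p) (h (projT1 p) n (projT2 p)).

Lemma coprod_map_act m n (f : Delta m n) (p : coprod X n) :
  coprod_map_app (act f p) = act f (coprod_map_app p).
Proof. by rewrite /coprod_map_app /= app_act. Qed.

Definition coprod_map : hom (coprod X) (coprod Y) := Hom coprod_map_act.

End CoproductMap.

(*        f                                                                   *)
(*    A -----> C                                                              *)
(*  i |        | j                                                            *)
(*    B -----> D                                                              *)
(*        g                                                                   *)
Definition is_pushout (A B C D : sset) (i : hom A B) (f : hom A C)
  (j : hom C D) (g : hom B D) : Prop :=
  hom_comp g i = hom_comp j f /\
  forall (Z : sset) (u : hom B Z) (v : hom C Z),
    hom_comp u i = hom_comp v f ->
    exists! h : hom D Z, hom_comp h g = u /\ hom_comp h j = v.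

(* The i-th horn is the k i-th horn of the simplex of dimension (d i).+1.     *)
Definition horn_pushout (C D : sset) (j : hom C D) : Prop :=
  exists (I : Type) (d : I -> nat) (k : forall i, 'I_(d i).+2)
    (f : hom (coprod (fun i => sub_sset (horn (k i)))) C)
    (g : hom (coprod (fun i => simplex (d i).+1)) D),
    is_pushout (coprod_map (fun i => sub_emb (horn (k i)))) f j g.

(* For an ordinal kappa, the ordinals alpha <= kappa form a well-order with a *)
(* greatest element, and every such well-order arises, up to isomorphism,     *)
(* from a unique kappa; [index_type], [index_le] and [index_top] below play   *)
(* the roles of {alpha | alpha <= kappa}, <= and kappa.                       *)
Section Ordinals.
Variables (I : Type) (le : rel I).

Definition ord_lt (a b : I) : Prop := ~~ le b a.
Definition is_zero (a : I) : Prop := forall b, le a b.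
Definition is_succ (a b : I) : Prop :=
  ord_lt a b /\ forall c, ord_lt a c -> le b c.
Definition is_limit (b : I) : Prop :=
  ~ is_zero b /\ ~ exists a, is_succ a b.

End Ordinals.

Record anodyne_presentation (A B : sset) (m : hom A B) := AnodynePresentation {
  index_type : Type;
  index_le : rel index_type;
  index_top : index_type;
  index_wo : well_order index_le;
  index_topP : forall a, index_le a index_top;
  stage : index_type -> subcomplex B;
  stage_le : forall a b, index_le a b -> sub_le (stage a) (stage b);
  stage_zero : forall a, is_zero index_le a -> forall n, stage a n = range (m n);
  stage_top : forall n, stage index_top n = setT;
  stage_limit : forall b, is_limit index_le b ->
    forall n, stage b n = \bigcup_(a in [set a | ord_lt index_le a b]) stage a n;
  stage_succ : forall a b, is_succ index_le a b ->
    forall ab : sub_le (stage a) (stage b), horn_pushout (sub_incl ab) }.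

Definition strong_anodyne (A B : sset) (m : hom A B) : Prop :=
  monic m /\ inhabited (anodyne_presentation m).

Record face n := Face {
  face_set :> {set 'I_n.+1};
  face_neq0 : face_set != finset.set0 }.

HB.instance Definition _ n := [isSub for @face_set n].
HB.instance Definition _ n := [Choice of face n by <:].

Definition face_le n (A B : face n) := face_set A \subset face_set B.

Lemma face_le_refl n : reflexive (@face_le n).
Proof. by move=> A; exact: subxx. Qed.

Lemma face_le_anti n : antisymmetric (@face_le n).
Proof.
by move=> A B AB; apply: val_inj; apply/eqP; rewrite finset.eqEsubset.
Qed.

Lemma face_le_trans n : transitive (@face_le n).
Proof. by move=> B A C; exact: fintype.subset_trans. Qed.

HB.instance Definition _ n := Order.Le_isPOrder.Build Order.SetSubsetOrder.subset_display
  (face n) (@face_le_refl n) (@face_le_anti n) (@face_le_trans n).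

Lemma face_img_subproof m n (f : Delta m n) (A : face m) :
  f @: face_set A != finset.set0.
Proof. by rewrite imset_eq0 face_neq0. Qed.

Definition face_img m n (f : Delta m n) (A : face m) : face n :=
  Face (face_img_subproof f A).

Lemma face_img_homo m n (f : Delta m n) :
  {homo face_img f : A B / (A <= B)%O}.
Proof. by move=> A B; exact: imsetS. Qed.

HB.instance Definition _ m n (f : Delta m n) :=
  Order.isOrderMorphism.Build _ (face m) _ (face n) (face_img f)
    (face_img_homo f).

Definition sd_simplex n : sset := nerve (face n).

Definition sd_simplex_map m n (f : Delta m n) :
  hom (sd_simplex m) (sd_simplex n) := nerve_map (face_img f).

Lemma sd_simplex_map_id n : sd_simplex_map (omorph_id 'I_n.+1) = hom_id _.
Proof.
apply: hom_eq => m x; apply: omorph_eq => i; apply: val_inj => /=.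
by rewrite imset_id.
Qed.

Lemma sd_simplex_map_comp l m n (g : Delta m n) (f : Delta l m) :
  sd_simplex_map (omorph_comp g f)
  = hom_comp (sd_simplex_map g) (sd_simplex_map f).
Proof.
apply: hom_eq => k x; apply: omorph_eq => i; apply: val_inj => /=.
by rewrite imset_comp.
Qed.

(* [ord0] is a neutral default: the maximum is taken over a non-empty set.    *)
Definition face_max n (A : face n) : 'I_n.+1 :=
  (\big[Order.max/ord0]_(i in face_set A) i)%O.

Lemma face_max_mem n (A : face n) : face_max A \in face_set A.
Proof.
have [i iA] := finset.set0Pn _ (face_neq0 A).
have : (face_max A \in face_set A) || (face_max A == ord0).
  rewrite /face_max; elim/big_ind: _ => [|x y|j ->//].
  - by rewrite eqxx orbT.
  - by rewrite maxEle; case: ifP.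
case/orP=> // /eqP mx0; suff -> : face_max A = i by [].
apply/val_inj/eqP; rewrite mx0 /= eq_sym -leqn0.
by have := le_bigmax_cond ord0 id iA; rewrite -/(face_max A) mx0.
Qed.

Lemma face_max_ub n (A : face n) i : i \in face_set A -> (i <= face_max A)%O.
Proof. by move=> iA; exact: (le_bigmax_cond ord0 id iA). Qed.

Lemma face_max_homo n : {homo @face_max n : A B / (A <= B)%O}.
Proof.
move=> A B /fintype.subsetP AB; apply/face_max_ub/AB/face_max_mem.
Qed.

HB.instance Definition _ n :=
  Order.isOrderMorphism.Build _ (face n) _ 'I_n.+1 (@face_max n)
    (@face_max_homo n).

Definition last_vertex n : hom (sd_simplex n) (simplex n) :=
  nerve_map (@face_max n).

Lemma last_vertex_natural m n (f : Delta m n) :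
  hom_comp (last_vertex n) (sd_simplex_map f)
  = hom_comp (nerve_map f) (last_vertex m).
Proof.
apply: hom_eq => k x; apply: omorph_eq => i /=.
apply/eqP; rewrite eq_le; apply/andP; split.
  have /imsetP[a aA /= ->] := face_max_mem (face_img f (x i)).
  by apply: omorph_le; exact: face_max_ub.
by apply: face_max_ub; apply: imset_f; exact: face_max_mem.
Qed.

Section Ex.
Variable X : sset.

Definition Ex_act m n (f : Delta m n) (s : hom (sd_simplex n) X) :
  hom (sd_simplex m) X := hom_comp s (sd_simplex_map f).

Lemma Ex_act_id n (s : hom (sd_simplex n) X) : Ex_act (omorph_id _) s = s.
Proof. by rewrite /Ex_act sd_simplex_map_id; exact: hom_eq. Qed.

Lemma Ex_act_comp l m n (g : Delta m n) (f : Delta l m)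
  (s : hom (sd_simplex n) X) :
  Ex_act (omorph_comp g f) s = Ex_act f (Ex_act g s).
Proof. by rewrite /Ex_act sd_simplex_map_comp; exact: hom_eq. Qed.

Definition Ex : sset :=
  @SSet (fun n => hom (sd_simplex n) X) Ex_act Ex_act_id Ex_act_comp.

Definition Ex_unit_app n (x : X n) : Ex n :=
  hom_comp (yoneda x) (last_vertex n).

Lemma Ex_unit_act m n (f : Delta m n) (x : X n) :
  Ex_unit_app (act f x) = act f (Ex_unit_app x).
Proof.
rewrite /= /Ex_act /Ex_unit_app.
have -> : yoneda (act f x) = hom_comp (yoneda x) (nerve_map f).
  by apply: hom_eq => k s; rewrite /= act_comp.
have -> : forall (a : hom (simplex n) X), hom_comp (hom_comp a (nerve_map f))
   (last_vertex m) = hom_comp a (hom_comp (nerve_map f) (last_vertex m)).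
  by move=> a; exact: hom_eq.
by rewrite -last_vertex_natural; exact: hom_eq.
Qed.

Definition Ex_unit : hom X Ex := Hom Ex_unit_act.

End Ex.

(* Degreewise, the colimit of X 0 -> X 1 -> ... is the quotient of the        *)
(* disjoint union of the X k by the equivalence relation generated by         *)
(* x ~ j k x; its elements are represented as equivalence classes.            *)
Section SequentialColimit.
Variables (X : nat -> sset) (j : forall k, hom (X k) (X k.+1)).

Inductive colim_step n : {k : nat & X k n} -> {k : nat & X k n} -> Prop :=
  ColimStep k (x : X k n) :
    colim_step (existT (fun k => X k n) k x)
               (existT (fun k => X k n) k.+1 (j k n x)).

Definition colim_rel n (p : {k : nat & X k n}) : set {k : nat & X k n} :=
  clos_refl_sym_trans _ (@colim_step n) p.

Definition colim_simp n : Type := range (@colim_rel n).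

Definition colim_class n (p : {k : nat & X k n}) : colim_simp n :=
  SigSub (mem_set (imageT (@colim_rel n) p)).

Lemma colim_classP n (c : colim_simp n) : exists p, c = colim_class p.
Proof.
by case: c => C hC; have [p _ pC] := set_mem hC; exists p; apply: val_inj.
Qed.

Lemma colim_class_eq n (p q : {k : nat & X k n}) :
  colim_class p = colim_class q <-> colim_rel p q.
Proof.
split=> [/(congr1 val) /= ->|pq]; first exact: rst_refl.
apply: val_inj; apply/seteqP; split=> r /= h.
  by apply: rst_trans h; exact: rst_sym.
exact: rst_trans h.
Qed.

Lemma colim_rel_act m n (f : Delta m n) (p q : {k : nat & X k n}) :
  colim_rel p q -> colim_rel (coprod_act f p) (coprod_act f q).
Proof.
elim=> {p q} [_ _ [k x]|p|p q _ pq|p q r _ pq _ qr].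
- by rewrite /coprod_act /= -app_act; apply: rst_step.
- exact: rst_refl.
- exact: rst_sym.
- exact: rst_trans qr.
Qed.

Lemma colim_act_subproof m n (f : Delta m n) (c : colim_simp n) :
  range (@colim_rel m)
    (\bigcup_(p in val c) colim_rel (coprod_act f p)).
Proof.
have [p ->] := colim_classP c; exists (coprod_act f p) => //.
apply/seteqP; split=> [q pq|q [r /= pr]]; last first.
  by apply: rst_trans; exact: colim_rel_act.
by exists p => //; exact: rst_refl.
Qed.

Definition colim_act m n (f : Delta m n) (c : colim_simp n) : colim_simp m :=
  SigSub (mem_set (colim_act_subproof f c)).

Lemma colim_act_class m n (f : Delta m n) (p : {k : nat & X k n}) :
  colim_act f (colim_class p) = colim_class (coprod_act f p).
Proof.
apply: val_inj; apply/seteqP; split=> [q [r /= pr]|q pq].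
  by apply: rst_trans; exact: colim_rel_act.
by exists p => //; exact: rst_refl.
Qed.

Lemma colim_act_id n (c : colim_simp n) : colim_act (omorph_id _) c = c.
Proof.
by have [p ->] := colim_classP c; rewrite colim_act_class coprod_act_id.
Qed.

Lemma colim_act_comp l m n (g : Delta m n) (f : Delta l m) (c : colim_simp n) :
  colim_act (omorph_comp g f) c = colim_act f (colim_act g c).
Proof.
have [p ->] := colim_classP c.
by rewrite !colim_act_class coprod_act_comp.
Qed.

Definition colim : sset := @SSet colim_simp colim_act colim_act_id
  colim_act_comp.

Definition colim_in_app k n (x : X k n) : colim n :=
  colim_class (existT (fun k => X k n) k x).

Lemma colim_in_act k m n (f : Delta m n) (x : X k n) :
  colim_in_app (act f x) = act f (colim_in_app x).
Proof. by rewrite /colim_in_app /= colim_act_class. Qed.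

Definition colim_in k : hom (X k) colim := Hom (@colim_in_act k).

Lemma colim_in_compat k : hom_comp (colim_in k.+1) (j k) = colim_in k.
Proof.
apply: hom_eq => n x; apply/colim_class_eq/rst_sym/rst_step.
exact: ColimStep.
Qed.

Lemma colim_universal (Z : sset) (c : forall k, hom (X k) Z) :
  (forall k, hom_comp (c k.+1) (j k) = c k) ->
  exists! h : hom colim Z, forall k, hom_comp h (colim_in k) = c k.
Proof.
move=> cj; pose u n (p : {k : nat & X k n}) : Z n := c (projT1 p) n (projT2 p).
have u_rel n (p q : {k : nat & X k n}) : colim_rel p q -> u n p = u n q.
  elim=> {p q} [_ _ [k x]|//|p q _ ->//|p q r _ -> _ ->//].
  by rewrite /u /= -[in LHS]cj.
pose rep n (s : colim n) := projT1 (cid (colim_classP s)).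
have repK n s : s = colim_class (@rep n s).
  exact: projT2 (cid (colim_classP s)).
have u_rep n p : u n (rep n (colim_class p)) = u n p.
  by apply/u_rel/colim_class_eq; rewrite -repK.
have h_act m n (f : Delta m n) (s : colim n) :
  u m (rep m (act f s)) = act f (u n (rep n s)).
  rewrite [s in LHS]repK /= colim_act_class u_rep /u /=.
  exact: app_act.
exists (@Hom colim Z (fun n s => u n (rep n s)) h_act); split=> [k|h hc].
  by apply: hom_eq => n x; exact: u_rep.
apply: hom_eq => n s; rewrite /= [s in RHS]repK.
by rewrite /u -hc; congr (h n _); case: (rep n s).
Qed.

End SequentialColimit.

Fixpoint Ex_iter (X : sset) (k : nat) : sset :=
  if k is k'.+1 then Ex (Ex_iter X k') else X.

Definition Ex_iter_unit (X : sset) (k : nat) :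
  hom (Ex_iter X k) (Ex_iter X k.+1) := Ex_unit (Ex_iter X k).

Definition Ex_infty (X : sset) : sset := colim (Ex_iter_unit X).

Definition Ex_infty_unit (X : sset) : hom X (Ex_infty X) :=
  colim_in (Ex_iter_unit X) 0.

(* Main.v *)
Require Import Defs.
From HB Require Import structures.
From mathcomp Require Import all_boot all_order zify.
From mathcomp Require Import boolp classical_sets wochoice.

Set Implicit Arguments.
Unset Strict Implicit.
Unset Printing Implicit Defensive.

Import Order.TTheory.

Local Open Scope classical_set_scope.

(** Call a monomorphism [A -> B] paired when the nondegenerate simplices of [B]
    outside [A] are matched in couples, a child [s] of dimension [n] with a
    parent [P s] of dimension [n + 1], such that [s] is one codimension-one face
    of [P s] and all the other faces of [P s] are generated by [A] and by
    parents of strictly smaller rank.  Attaching the parents in the order of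
    their ranks attaches simplices along horns: the face opposite to the missing
    one is the child, which is new, and every other face is already there.  This
    is [ranked_strong_anodyne]; as ranks are natural numbers, the stages are
    indexed by the ordinal omega + 1.

    The pairing on [Ex Y].  A simplex of [Ex Y] is a map [w : sd n -> Y], and
    every endomorphism of the poset of faces of [n] acts on such maps.  The
    operator [fill k] adds the vertices below [k] to the faces containing [k].
    The operators [fill 0, ..., fill n] compose to [A |-> {0, ..., max A}], so
    [w] comes from [Y] exactly when all of them fix [w] ([filled_range]).  When
    [w] does not come from [Y], let [i] be the largest index for which [fill i]
    moves [w].  The parent of [w] inserts a new vertex just after [i], which
    stands for the face [{0, ..., i}] ([insert]).  The child is the face of the
    parent opposite to that new vertex.  A nondegenerate simplex with last
    unfilled vertex [i] is a parent ([typeI]) when its vertex [i + 1] already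
    stands for [{0, ..., i}] in this way, which is invariance under [reduce i];
    otherwise it is a child ([typeII]).

    Two facts about the faces of the parent of [w] make the ranks decrease
    ([insert_faces]).  The face opposite to a vertex [l > i + 1] keeps the
    inserted vertex, so it is degenerate or a parent, and its child has lower
    dimension.  In the face opposite to a vertex [l <= i], the last unfilled
    vertex is smaller than [i], because the inserted vertex is filled and the
    vertices up to [i] are removed or shifted down.

    For the colimit it suffices to take all these pairs for all the maps
    [Ex^k X -> Ex^(k+1) X] together.  These maps are injective, so each simplex
    of the colimit is new at exactly one level.  The rank of the pair whose
    child has dimension [n], lives in [Ex^(k+1) X] and has last unfilled vertex
    [i] is [2 ^ (n + k + 1) + i]: lowering the dimension or the level costs a
    factor of two, which outweighs [i <= n] ([rank_bound]). *)

(** * Operators of the simplex category *)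

Definition omorph_of d (P : porderType d) d' (Q : porderType d') (f : P -> Q)
  (hf : {homo f : x y / (x <= y)%O}) : {omorphism P -> Q} :=
  HB.pack f (Order.isOrderMorphism.Build _ P _ Q f hf).

(** Operators between ordinals are given by functions on natural numbers, so
    that identities between them become arithmetic. *)
Lemma inord_homo m n (f : nat -> nat) :
  (forall a, a <= m -> f a <= n) -> {homo f : a b / a <= b} ->
  {homo (fun a : 'I_m.+1 => inord (f a) : 'I_n.+1) : a b / (a <= b)%O}.
Proof.
move=> fn fh a b ab; rewrite leEord /= !inordK ?ltnS; last 2 first.
- exact/fn/leq_ord.
- exact/fn/leq_ord.
exact: fh.
Qed.

Lemma coface_homo n l :
  {homo (fun a : 'I_n.+1 => inord (bump l a) : 'I_n.+2) : a b / (a <= b)%O}.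
Proof.
by apply: (@inord_homo n n.+1 (bump l)) => [a|a b]; rewrite /bump; lia.
Qed.

Definition coface n l : Delta n n.+1 := omorph_of (@coface_homo n l).

Lemma codegen_homo n l :
  {homo (fun a : 'I_n.+2 => inord (minn n (unbump l a)) : 'I_n.+1)
     : a b / (a <= b)%O}.
Proof.
by apply: (@inord_homo n.+1 n (fun a => minn n (unbump l a))) => [a|a b];
  rewrite /unbump; lia.
Qed.

Definition codegen n l : Delta n.+1 n := omorph_of (@codegen_homo n l).

Lemma fuse_homo n l :
  {homo (fun a : 'I_n.+1 => inord (if a == l.+1 :> nat then l else a) : 'I_n.+1)
     : a b / (a <= b)%O}.
Proof.
apply: (@inord_homo n n (fun a => if a == l.+1 then l else a)) => [a|a b].
  by case: eqP; lia.
by do 2![case: eqP]; lia.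
Qed.

(** The idempotent operator that sends [l + 1] to [l]: being degenerate along
    this edge means being fixed by it, which avoids naming the simplex of lower
    dimension. *)
Definition fuse n l : Delta n n := omorph_of (@fuse_homo n l).

Lemma coface_val n l (a : 'I_n.+1) : coface n l a = bump l a :> nat.
Proof. by rewrite /= inordK // /bump; case: a => a /=; lia. Qed.

Lemma fuse_val n l (a : 'I_n.+1) :
  fuse n l a = (if a == l.+1 :> nat then l else a) :> nat.
Proof. by rewrite /= inordK //; case: a => a /=; case: eqP; lia. Qed.

Lemma codegen_val n l (a : 'I_n.+2) :
  codegen n l a = minn n (unbump l a) :> nat.
Proof. by rewrite /= inordK // ltnS geq_minl. Qed.

(** * Nondegenerate simplices *)

Section Nondegenerate.
Variable B : sset.

Definition nondeg n (x : B n) : Prop :=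
  forall l, l < n -> act (fuse n l) x <> x.

Definition strict_steps m n (f : Delta m n) : Prop :=
  forall l, l < m -> f (inord l) != f (inord l.+1).

Definition surj m n (f : Delta m n) : Prop := forall y, exists a, f a = y.

(** A monotone map with distinct consecutive values grows at least as fast as
    its argument; this gives both the inequality of dimensions and the rigidity
    of endomorphisms. *)
Lemma strict_growth m n (f : Delta m n) : strict_steps f ->
  forall i j : 'I_m.+1, i <= j -> f i + (j - i) <= f j.
Proof.
move=> fs i j; case: j => j; elim: j => [|j IH] jm /= ij.
  have -> : i = Ordinal jm by apply: val_inj => /=; lia.
  by rewrite subnn addn0.
move: ij; rewrite leq_eqVlt => /orP[/eqP ij|ij].
  have -> : i = Ordinal jm by exact: val_inj.
  by rewrite subnn addn0.
have jm' : j < m.+1 by lia.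
have := IH jm' ij; have := fs j jm.
have -> : inord j = Ordinal jm' by apply: val_inj; rewrite /= inordK.
have -> : inord j.+1 = Ordinal jm by apply: val_inj; rewrite /= inordK.
have : (f (Ordinal jm') <= f (Ordinal jm))%O.
  by apply: omorph_le; rewrite leEord /=.
rewrite leEord /= -(inj_eq val_inj) /=.
move: (nat_of_ord (f _)) (nat_of_ord (f _)) (nat_of_ord (f _)) => a b c.
by move=> ab /eqP; lia.
Qed.

Lemma strict_leq m n (f : Delta m n) : strict_steps f -> m <= n.
Proof.
move=> /strict_growth/(_ ord0 ord_max (leq0n _)) /= h.
by have := ltn_ord (f ord_max); lia.
Qed.

Lemma strict_id n (f : Delta n n) : strict_steps f -> f = omorph_id _.
Proof.
move=> /strict_growth fg; apply: omorph_eq => i; apply: val_inj => /=.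
have := fg ord0 i (leq0n _); have := fg i ord_max (leq_ord i).
have := ltn_ord (f ord_max); have := ltn_ord i; rewrite /=.
move: (nat_of_ord i) (nat_of_ord (f i)) (nat_of_ord (f ord0)) (nat_of_ord (f
  ord_max)) => a b c e.
by lia.
Qed.

(** If [f] identified [l] and [l + 1], then [fuse l] would fix [x]. *)
Lemma nondeg_strict n (x : B n) m (f : Delta n m) y :
  nondeg x -> x = act f y -> strict_steps f.
Proof.
move=> xn xy l ln; apply/eqP => fl; apply: (xn l ln).
rewrite xy -act_comp; congr (act _ y); apply: omorph_eq => a /=.
case: eqP => [al|_]; last by rewrite inord_val.
by rewrite fl -al inord_val.
Qed.

Lemma degenerate_factor n (x : B n) : ~ nondeg x ->
  exists m (y : B m) (f : Delta n m), m < n /\ x = act f y.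
Proof.
move=> /existsNP[l /not_implyP[ln /contrapT xl]].
case: n x ln xl => // n x ln xl.
exists n, (act (coface n l.+1) x), (codegen n l); split=> //.
rewrite -act_comp -[LHS]xl; congr (act _ x).
apply: omorph_eq => a; apply: ord_inj.
rewrite fuse_val [RHS]coface_val codegen_val /bump /unbump.
by move: (nat_of_ord a) (ltn_ord a) => b; case: eqP; lia.
Qed.

Lemma nondeg_root n (x : B n) :
  exists m (y : B m) (f : Delta n m), [/\ m <= n, nondeg y & x = act f y].
Proof.
elim/ltn_ind: n x => n IH x.
have [xn|/degenerate_factor[m [y [f [mn ->]]]]] := pselect (nondeg x).
  by exists n, x, (omorph_id _); split; rewrite ?act_id.
have [l [z [g [lm zn ->]]]] := IH m mn y.
exists l, z, (omorph_comp g f); rewrite act_comp; split=> //.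
exact: leq_trans lm (ltnW mn).
Qed.

(** Sections of a surjection separate its points: the one chosen here goes
    through a prescribed [p]. *)
Lemma surj_section m n (f : Delta m n) (p : 'I_m.+1) : surj f ->
  exists d : Delta n m, d (f p) = p /\ forall y, f (d y) = y.
Proof.
move=> fs; pose d y := if y == f p then p else projT1 (cid (fs y)).
have fd y : f (d y) = y.
  by rewrite /d; have [->|_] := eqVneq y (f p) => //;
    exact: projT2 (cid (fs y)).
have dh : {homo d : y z / (y <= z)%O}.
  move=> y z yz; case: (leP (d y) (d z)) => // dzy.
  have := omorph_le f (ltW dzy); rewrite !fd => zy.
  by move: dzy; rewrite (le_anti (introT andP (conj yz zy))) ltxx.
by exists (omorph_of dh); split=> //=; rewrite /d eqxx.
Qed.

(** The uniqueness part of the Eilenberg-Zilber lemma.  A section [d] of [f]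
    exhibits [x] as the image of [y] under [g o d], which is then strictly
    increasing; exchanging the roles makes the dimensions equal, so [g o d] is
    the identity, for a section [d] through any given point. *)
Lemma nondeg_unique a b m (x : B a) (y : B b) (f : Delta m a) (g : Delta m b) :
  nondeg x -> nondeg y -> surj f -> surj g -> act f x = act g y ->
  existT (fun n => (B n * Delta m n)%type) a (x, f) = existT _ b (y, g).
Proof.
move=> xn yn fs gs fg.
have key c e (u : B c) (v : B e) (h : Delta m c) (h' : Delta m e)
      (d : Delta c m) :
    act h u = act h' v -> (forall z, h (d z) = z) ->
    u = act (omorph_comp h' d) v.
  move=> huv hd; rewrite act_comp -huv -act_comp.
  by rewrite -[LHS]act_id; congr (act _ u); apply: omorph_eq => z /=.
have leq c e (u : B c) (v : B e) (h : Delta m c) (h' : Delta m e) :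
    act h u = act h' v -> nondeg u -> surj h -> c <= e.
  move=> huv un /(@surj_section _ _ _ ord0)[d [_ hd]].
  exact: strict_leq (nondeg_strict un (key _ _ _ _ _ _ _ huv hd)).
have ab : a = b by apply/eqP;
  rewrite eqn_leq (leq _ _ _ _ _ _ fg) ?(leq _ _ _ _ _ _ (esym fg)).
case: _ / ab in y yn g gs fg *.
have gd p : exists d : Delta a m, [/\ d (f p) = p,
  omorph_comp g d = omorph_id _ & x = y].
  have [d [dp fd]] := surj_section p fs; exists d.
  have xy := key _ _ _ _ _ _ _ fg fd.
  have gd := strict_id (nondeg_strict xn xy).
  by split=> //; rewrite xy gd act_id.
have [_ [_ _ ->]] := gd ord0.
suff -> : f = g by [].
apply: omorph_eq => p.
have [d [dp gdE _]] := gd p.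
by rewrite -[in RHS]dp; have := congr1 (fun h : Delta a a => h (f p)) gdE.
Qed.

End Nondegenerate.

(** * Attaching simplices along horns *)

(** If each simplex of [D] outside [C] lies in exactly one cell, at exactly one
    operator outside the horn, then a map on [D] is freely determined by its
    restrictions to [C] and to the cells. *)

Section CellPushout.
Variables (B : sset) (C D : subcomplex B) (CD : sub_le C D).
Variables (I : Type) (d : I -> nat) (k : forall i, 'I_(d i).+2).
Variable p : forall i, B (d i).+1.
Hypothesis p_in : forall i, D _ (p i).
Hypothesis p_horn : forall i m (f : simplex (d i).+1 m),
  horn (k i) m f -> C _ (act f (p i)).
Hypothesis p_notin : forall i m (f : simplex (d i).+1 m),
  ~ horn (k i) m f -> ~ C _ (act f (p i)).
Hypothesis p_cover : forall m (x : B m), D _ x -> ~ C _ x ->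
  exists i (f : simplex (d i).+1 m), x = act f (p i).
Hypothesis p_unique : forall m i j (f : simplex (d i).+1 m)
    (g : simplex (d j).+1 m),
  ~ horn (k i) m f -> ~ horn (k j) m g -> act f (p i) = act g (p j) ->
  existT (fun i => simplex (d i).+1 m) i f = existT _ j g.

Definition attach_app m (q : coprod (fun i => sub_sset (horn (k i))) m) :
  sub_sset C m :=
  SigSub (mem_set (p_horn (set_mem (valP (projT2 q))))).

Lemma attach_act m n (f : Delta m n) q :
  attach_app (act f q) = act f (attach_app q).
Proof. by apply: val_inj; rewrite /= -act_comp. Qed.

Definition charact_app m (q : coprod (fun i => simplex (d i).+1) m) :
  sub_sset D m :=
  SigSub (mem_set (sub_act (projT2 q) (p_in (projT1 q)))).

Lemma charact_act m n (f : Delta m n) q :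
  charact_app (act f q) = act f (charact_app q).
Proof. by apply: val_inj; rewrite /= -act_comp. Qed.

Lemma cell_pushout : horn_pushout (sub_incl CD).
Proof.
exists I, d, k, (Hom attach_act), (Hom charact_act); split.
  by apply: hom_eq => n q; exact: val_inj.
move=> Z u v uv.
have cov m (x : sub_sset D m) : ~ C _ (val x) ->
    {q : coprod (fun i => simplex (d i).+1) m | x = charact_app q}.
  move=> xC; apply: cid.
  have [i [f xf]] := p_cover (set_mem (valP x)) xC.
  by exists (existT _ i f); apply: val_inj.
pose h m (x : sub_sset D m) : Z m :=
  match pselect (C _ (val x)) with
  | left xC => v m (SigSub (mem_set xC))
  | right xC => u m (projT1 (cov m x xC))
  end.
have hC m (x : sub_sset C m) : h m (sub_widen CD x) = v m x.
  rewrite /h; case: pselect => [xC|/(_ (set_mem (valP x))) //].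
  by congr (v m _); apply: val_inj.
have hD m q : h m (charact_app q) = u m q.
  case: q => i f; have [fh|fh] := pselect (horn (k i) m f).
    pose q' : coprod (fun i => sub_sset (horn (k i))) m :=
      existT _ i (SigSub (mem_set fh)).
    have -> : charact_app (existT _ i f) = sub_widen CD (attach_app q') by
      exact: val_inj.
    by rewrite hC; have /= <- := congr1 (fun h => app h q') uv.
  rewrite /h; case: pselect => [/(p_notin fh) //|fC].
  case: (cov _ _ _) => /= -[j g] /(congr1 val) /= fg; congr (u m _).
  have [gh|gh] := pselect (horn (k j) m g); last exact/esym/p_unique.
  by case: (p_notin fh); rewrite fg; exact: p_horn.
have h_act m n (f : Delta m n) (x : sub_sset D n) :
    h m (act f x) = act f (h n x).
  have [xC|/cov[q ->]] := pselect (C _ (val x)).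
    have -> : x = sub_widen CD (SigSub (mem_set xC)) by exact: val_inj.
    by rewrite -sub_widen_act !hC app_act.
  by rewrite -charact_act !hD app_act.
exists (Hom h_act); split; first by split; apply: hom_eq => m x;
  rewrite /= ?hC ?hD.
move=> h' [h'D h'C]; apply: hom_eq => m x /=.
have [xC|/cov[q ->]] := pselect (C _ (val x)).
  have -> : x = sub_widen CD (SigSub (mem_set xC)) by exact: val_inj.
  by rewrite hC -h'C.
by rewrite hD -h'D.
Qed.

End CellPushout.

(** * A pairing criterion for strong anodyne extensions *)

Lemma existT_inj (T : Type) (P : T -> Type) t (x y : P t) :
  existT P t x = existT P t y -> x = y.
Proof.
move=> E; have := projT2_eq E.
by rewrite (Prop_irrelevance (projT1_eq E) erefl).
Qed.

Lemma existT_map (P : nat -> Type) (Q : nat -> Type) (h : forall n, P n -> Q n)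
    a b (x : P a) (y : P b) :
  existT P a x = existT P b y -> existT Q a (h a x) = existT Q b (h b y).
Proof. by move/(congr1 (fun z => existT Q (projT1 z) (h _ (projT2 z)))). Qed.

Lemma coface_factor m n (f : Delta m n.+1) (l : nat) : l <= n.+1 ->
  (forall a, f a != l :> nat) ->
  f = omorph_comp (coface n l) (omorph_comp (codegen n l) f).
Proof.
move=> ln fl; apply: omorph_eq => a; apply: ord_inj; rewrite [RHS]coface_val.
rewrite codegen_val /bump /unbump; have := fl a; have := ltn_ord (f a).
move: (nat_of_ord (f a)) => b; lia.
Qed.

Lemma codegen_coface n l : omorph_comp (codegen n l) (coface n l) = omorph_id _.
Proof.
apply: omorph_eq => a; apply: ord_inj.
rewrite codegen_val coface_val /bump /unbump; have := ltn_ord a.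
rewrite /=; lia.
Qed.

(** Outside the horn, a map to the simplex is onto, or onto the face opposite to
    [k]; hence a simplex that is new in a cell is a degeneracy of the parent or
    of the child. *)
Lemma not_horn m n (k : 'I_n.+2) (f : Delta m n.+1) :
  ~ horn k m f ->
  surj f \/ exists2 g : Delta m n, surj g & f = omorph_comp (coface n k) g.
Proof.
move=> fh.
have fs l : l != k -> exists a, f a = l.
  move=> lk; apply: contrapT => /forallNP fl; apply: fh; exists l => // a.
  by apply/eqP.
have [[a ak]|/forallNP fk] := pselect (exists a, f a = k).
  by left=> l; have [->|/fs//] := eqVneq l k; exists a.
right; have fE := @coface_factor _ _ f k (leq_ord k).
have {}fE : f = omorph_comp (coface n k) (omorph_comp (codegen n k) f).
  by apply: fE => a; apply/eqP => /ord_inj /(fk a).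
exists (omorph_comp (codegen n k) f) => // y.
have [|a fa] := fs (coface n k y).
  by apply/eqP => /(congr1 (@nat_of_ord _)) /eqP; rewrite coface_val;
    apply/negP; rewrite eq_sym neq_bump.
exists a; rewrite /= fa.
by have := congr1 (fun h : Delta n n => h y) (codegen_coface n k).
Qed.

(** The ordinal omega + 1; [None] is its top. *)
Definition rank_le : rel (option nat) := fun a b =>
  match a, b with
  | _, None => true
  | None, Some _ => false
  | Some r, Some s => r <= s
  end.

Lemma rank_le_wo : well_order rank_le.
Proof.
move=> S [z zS].
have [[r rS]|noS] := pselect (exists r, Some r \in S).
  have exS : exists r, Some r \in S by exists r.
  case: (ex_minnP exS) => m mS mmin; exists (Some m); split.
    by split=> // -[s|] // /mmin.
  move=> [s|] [sS slow]; last by have := slow _ mS.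
  by congr Some; apply/eqP; rewrite eqn_leq mmin //=; exact: slow _ mS.
have SN y : y \in S -> y = None.
  by case: y => // r rS; case: noS; exists r.
exists None; split; first by split=> [|y /SN ->] //; rewrite -(SN z).
by move=> y [/SN ->].
Qed.

Section Criterion.
Variables (A B : sset) (m : hom A B) (mono_m : monic m).
Variables (J : Type) (dim : J -> nat) (k : forall j, 'I_(dim j).+2).
Variables (parent : forall j, B (dim j).+1) (rank : J -> nat).

Definition child j : B (dim j) := act (coface _ (k j)) (parent j).

(** The simplices present at stage [a]: those of [A] and the cells of rank less
    than [a].  The strict inequality makes stage [0] equal to [A] and each limit
    stage a union. *)
Definition generated (a : option nat) n (x : B n) : Prop :=
  range (m n) x \/ exists j (f : Delta n (dim j).+1),
    rank_le (Some (rank j).+1) a /\ x = act f (parent j).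

Lemma generated_act a l n (f : Delta l n) (x : B n) :
  generated a x -> generated a (act f x).
Proof.
move=> [[y _ <-]|[j [g [ja ->]]]].
  by left; exists (act f y) => //; rewrite app_act.
by right; exists j, (omorph_comp g f); rewrite act_comp.
Qed.

Lemma generated_le a b n (x : B n) :
  rank_le a b -> generated a x -> generated b x.
Proof.
move=> ab [?|[j [f [ja xE]]]]; [by left|right; exists j, f; split=> //].
by case: a b ab ja => [a|] [b|] //= ab ja; exact: leq_trans ab.
Qed.

Hypothesis parent_nondeg : forall j, nondeg (parent j).
Hypothesis child_nondeg : forall j, nondeg (child j).
Hypothesis child_notin : forall j, ~ range (m _) (child j).
Hypothesis parent_inj : forall i j,
  existT B _ (parent i) = existT B _ (parent j) -> i = j.
Hypothesis child_inj : forall i j,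
  existT B _ (child i) = existT B _ (child j) -> i = j.
Hypothesis child_parent : forall i j,
  existT B _ (child i) <> existT B _ (parent j).
Hypothesis cover : forall n (x : B n), nondeg x ->
  [\/ range (m n) x, exists j, existT B n x = existT B _ (child j)
    | exists j, existT B n x = existT B _ (parent j)].
Hypothesis faces : forall j l, l <= (dim j).+1 -> l != k j ->
  generated (Some (rank j)) (act (coface _ l) (parent j)).

Definition stage_of a : subcomplex B :=
  @Subcomplex B (generated a) (@generated_act a).

Lemma horn_generated j n (f : simplex (dim j).+1 n) :
  horn (k j) n f -> generated (Some (rank j)) (act f (parent j)).
Proof.
move=> [l lk fl]; rewrite (@coface_factor _ _ f l (leq_ord l)); last first.
  by move=> a; exact: fl.
by rewrite act_comp; apply/generated_act/faces; [exact: leq_ord|].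
Qed.

(** By uniqueness of nondegenerate roots, two new simplices agree only if their
    roots do, and a root determines its couple and its place in it. *)
Lemma cell_unique n i j (f : Delta n (dim i).+1) (g : Delta n (dim j).+1) :
  ~ horn (k i) n f -> ~ horn (k j) n g ->
  act f (parent i) = act g (parent j) ->
  existT (fun i => Delta n (dim i).+1) i f = existT _ j g.
Proof.
have fstE a b (p : B a * Delta n a) (q : B b * Delta n b) :
    existT (fun n' => (B n' * Delta n n')%type) a p = existT _ b q ->
    existT B a p.1 = existT B b q.1.
  exact: (@existT_map (fun n' => (B n' * Delta n n')%type) B (fun _ p => p.1)).
move=> /not_horn[fs|[f' f's ->]] /not_horn[gs|[g' g's ->]].
- move=> /(nondeg_unique (@parent_nondeg i) (@parent_nondeg j) fs gs) E.
  have /= /parent_inj ij := fstE _ _ _ _ E.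
  by case: _ / ij in g gs E *; have [->] := existT_inj E.
- rewrite act_comp.
  move=> /(nondeg_unique (@parent_nondeg i) (@child_nondeg j) fs g's) E.
  by have /= /esym/child_parent := fstE _ _ _ _ E.
- rewrite act_comp.
  move=> /(nondeg_unique (@child_nondeg i) (@parent_nondeg j) f's gs) E.
  by have /= /child_parent := fstE _ _ _ _ E.
- rewrite !act_comp.
  move=> /(nondeg_unique (@child_nondeg i) (@child_nondeg j) f's g's) E.
  have /= /child_inj ij := fstE _ _ _ _ E.
  by case: _ / ij in g g' g's E *; have [->] := existT_inj E.
Qed.

(** A section recovers the child from any new simplex of its cell. *)
Lemma cell_notin_range n i (f : Delta n (dim i).+1) :
  ~ horn (k i) n f -> ~ range (m n) (act f (parent i)).
Proof.
move=> fh [y _ yE]; apply: (@child_notin i).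
suff [d ->] : exists d : Delta (dim i) n, child i = act d (act f (parent i)).
  by exists (act d y) => //; rewrite app_act yE.
have sect m' n' (g : Delta m' n') : surj g -> exists d,
  omorph_comp g d = omorph_id _.
  move=> /(@surj_section _ _ _ ord0)[d [_ gd]].
  by exists d; apply: omorph_eq => z /=.
have [/sect[d fd]|[g /sect[d gd] ->]] := not_horn fh.
  exists (omorph_comp d (coface _ (k i))).
  rewrite -act_comp /child; congr (act _ _); apply: omorph_eq => z /=.
  by have /= -> := congr1 (fun h : Delta _ _ => h (coface _ (k i) z)) fd.
exists d; rewrite -act_comp /child; congr (act _ _); apply: omorph_eq => z /=.
by have /= -> := congr1 (fun h : Delta _ _ => h z) gd.
Qed.

(** If a new simplex of the cell [i] were already generated, then it would lie
    in a cell [j] of smaller rank; it is not new there by uniqueness, so it lies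
    in the horn of [j], hence is generated at the even smaller rank of [j]. *)
Lemma cell_notin n i (f : Delta n (dim i).+1) :
  ~ horn (k i) n f ->
  ~ generated (Some (rank i)) (act f (parent i)).
Proof.
move=> fh [/(cell_notin_range fh) //|].
suff main r : forall j (g : Delta n (dim j).+1), rank j < r -> r <= rank i ->
    act f (parent i) <> act g (parent j).
  by move=> [j [g [/= ji fg]]]; exact: main ji (leqnn _) fg.
elim: r => // r IH j g jr ri fg.
have [gh|gh] := pselect (horn (k j) n g); last first.
  have /(congr1 (@projT1 _ _)) /= ij := cell_unique fh gh fg.
  by rewrite ij in ri; lia.
have := horn_generated gh; rewrite -fg => -[/(cell_notin_range fh) //|].
by move=> [j' [g' [/= j'j fg']]]; apply: (IH j' g') fg'; lia.
Qed.

(** Every nondegenerate simplex outside [A] is a child or a parent, and both lie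
    in the cell of the parent. *)
Lemma generated_all n (x : B n) : generated None x.
Proof.
have [l [y [f [_ yn ->]]]] := nondeg_root x; apply: generated_act.
have transfer c (z : B c) :
    existT B l y = existT B c z -> generated None z -> generated None y.
  by move/(congr1 (fun p => generated None (projT2 p))) => /= ->.
have [?|[j /transfer]|[j /transfer]] := cover yn; first by left.
  by apply; right; exists j, (coface _ (k j)).
by apply; right; exists j, (omorph_id _); rewrite act_id.
Qed.

Theorem ranked_strong_anodyne : strong_anodyne m.
Proof.
split=> //; constructor.
apply: (@AnodynePresentation A B m (option nat) rank_le None rank_le_wo _
  stage_of).
- by case.
- by move=> a b ab n x; exact: generated_le.
- move=> a /(_ (Some 0)) a0 n; case: a a0 => [[|//]|//] _ /=.
  by apply/seteqP; split=> x; [move=> [//|[j [f []]]] | left].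
- by move=> n; apply/seteqP; split=> x //= _; exact: generated_all.
(* The only limit is the top. *)
- move=> [[|r]|] [nz ns] n.
  + by case: nz; case.
  + case: ns; exists (Some r); split; first by rewrite /ord_lt /= ltnn.
    by move=> [s|]; rewrite /ord_lt //= -ltnNge.
  apply/seteqP; split=> x /=; last by move=> [a _]; apply: generated_le;
    case: (a).
  move=> [xA|[j [f [_ xE]]]]; first by exists (Some 0) => //; left.
  by exists (Some (rank j).+1) => //; right; exists j, f; split=> /=.
(* Between the stages [r] and [r + 1], the cells of rank [r] are attached. *)
- move=> [r|] b [ab bmin] ab'; last first.
    by exfalso; move: ab; rewrite /ord_lt; case: (b).
  have br : b = Some r.+1.
    case: b ab bmin {ab'} => [s|] ab bmin.
      have := bmin (Some r.+1); rewrite /ord_lt /= ltnn => /(_ isT).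
      by move: ab; rewrite /ord_lt /= -ltnNge => ? ?; congr Some; lia.
    by have := bmin (Some r.+1); rewrite /ord_lt /= ltnn => /(_ isT).
  rewrite br in ab ab' bmin *.
  pose I := {j | rank j = r}.
  apply: (@cell_pushout B _ _ ab' I (fun i => dim (sval i))
    (fun i => k (sval i)) (fun i => parent (sval i))).
  + by move=> [i ir]; right; exists i, (omorph_id _); rewrite act_id /= ir.
  + by move=> [i ir] n f /horn_generated /=; rewrite ir.
  + by move=> [i ir] n f /cell_notin /=; rewrite ir.
  + move=> n x [xA|[j [f [/= jr xE]]]] xr; first by case: xr; left.
    have jr' : rank j = r.
      apply/eqP; rewrite eqn_leq -ltnS jr leqNgt; apply/negP => jr'.
      by apply: xr; right; exists j, f.
    by exists (exist _ j jr'), f.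
  + move=> n [i ir] [j jr] f g /= fh gh fg.
    move: (cell_unique fh gh fg); clear fh gh fg.
    rewrite /= in f g * => E.
    have ij := congr1 (@projT1 _ _) E.
    rewrite /= in ij; move: jr g E.
    case: j / ij => jr g E; rewrite -(existT_inj E).
    by rewrite (Prop_irrelevance ir jr).
Qed.

End Criterion.

(** * Additive maps between posets of faces *)

Definition has_vertex n (A : face n) (x : nat) : Prop :=
  exists2 a, a \in face_set A & a = x :> nat.

Lemma vertex_bound n (A : face n) x : has_vertex A x -> x <= n.
Proof. by move=> [a _ <-]; exact: leq_ord. Qed.

Lemma face_eq n (A B : face n) :
  (forall x, has_vertex A x <-> has_vertex B x) -> A = B.
Proof.
move=> AB; apply: val_inj; apply/setP => a.
have sub (C D : face n) : (has_vertex C a -> has_vertex D a) ->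
    a \in face_set C -> a \in face_set D.
  by move=> CD aC; have [|b bD /ord_inj <-] := CD; first by exists a.
by apply/idP/idP; apply: sub => /AB.
Qed.

(** Vertices are handled as natural numbers: [pt n k] and [below n k] stand for
    [{k}] and [{0, ..., k}] when [k <= n]. *)
Lemma pt_subproof n (k : nat) : [set inord k : 'I_n.+1]%SET != finset.set0.
Proof. by apply/finset.set0Pn; exists (inord k); rewrite finset.inE. Qed.

Definition pt n k : face n := Face (pt_subproof n k).

Lemma below_subproof n (k : nat) :
  [set x : 'I_n.+1 | x <= k]%SET != finset.set0.
Proof. by apply/finset.set0Pn; exists ord0; rewrite finset.inE. Qed.

Definition below n k : face n := Face (below_subproof n k).

Lemma vertex_pt n k x : k <= n -> has_vertex (pt n k) x <-> x = k.
Proof.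
move=> kn; split=> [[a]|->]; first by rewrite finset.inE => /eqP -> <-;
  rewrite inordK.
by exists (inord k); rewrite ?finset.inE // inordK.
Qed.

Lemma vertex_below n k x : k <= n -> has_vertex (below n k) x <-> x <= k.
Proof.
move=> kn; split=> [[a]|xk]; first by rewrite finset.inE => ak <-.
by exists (inord x); rewrite ?finset.inE inordK // ltnS (leq_trans xk).
Qed.

(** The union-preserving extension of a face-valued function on vertices. *)

Section Extension.
Variables (m n : nat) (F : nat -> face n).

Lemma spread_subproof (A : face m) :
  (\bigcup_(a in face_set A) face_set (F a))%SET != finset.set0.
Proof.
have [a aA] := finset.set0Pn _ (face_neq0 A).
have [x xF] := finset.set0Pn _ (face_neq0 (F a)).
by apply/finset.set0Pn; exists x; apply/bigcupP; exists a.
Qed.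

Lemma spread_homo : {homo (fun A => Face (spread_subproof A)) : A B / (A <=
  B)%O}.
Proof.
move=> A B /fintype.subsetP AB; apply/fintype.subsetP => x /bigcupP[a aA xa].
by apply/bigcupP; exists a => //; exact: AB.
Qed.

Definition spread : {omorphism face m -> face n} := omorph_of spread_homo.

Lemma vertex_spread A x :
  has_vertex (spread A) x <-> exists a, has_vertex A a /\ has_vertex (F a) x.
Proof.
split=> [[y /bigcupP[a aA ya] <-]|[_ [[a aA <-] [y ya <-]]]].
  by exists a; split; [exists a|exists y].
by exists y => //; apply/bigcupP; exists a.
Qed.

End Extension.

(** Preservation of unions, said as: the vertices of [h A] are those of the
    images of the vertices of [A]. Identities between additive maps need only be
    checked on vertices. *)
Definition additive m n (h : face m -> face n) : Prop := forall A x,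
  has_vertex (h A) x <-> exists a, has_vertex A a /\ has_vertex (h (pt m a)) x.

Lemma additive_spread m n (F : nat -> face n) : additive (@spread m n F).
Proof.
move=> A x; split=> [/vertex_spread[a [aA xa]]|[a [aA /vertex_spread[b [ba
  xb]]]]].
  exists a; split=> //; apply/vertex_spread; exists a; split=> //.
  by apply/vertex_pt => //; exact: vertex_bound aA.
apply/vertex_spread; exists a; split=> //.
by move: ba => /vertex_pt-/(_ (vertex_bound aA)) <-.
Qed.

Lemma vertex_img m n (f : Delta m n) (g : nat -> nat) (A : face m) x :
  (forall a, f a = g a :> nat) ->
  has_vertex (face_img f A) x <-> exists a, has_vertex A a /\ x = g a.
Proof.
move=> fg; split=> [[_ /imsetP[a aA ->] <-]|[_ [[a aA <-] ->]]].
  by exists a; split=> //; exists a.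
by exists (f a) => //; apply: imset_f.
Qed.

Lemma additive_img m n (f : Delta m n) : additive (face_img f).
Proof.
have fE a : f a = f (inord (nat_of_ord a)) :> nat by rewrite inord_val.
have iE B x := @vertex_img m n f (fun a => f (inord a)) B x fE; move=> A x.
split=> [/iE[a [aA ->]]|[a [aA /iE[b [ba ->]]]]].
  exists a; split=> //; apply/iE.
  by exists a; split=> //; apply/vertex_pt => //; exact: vertex_bound aA.
apply/iE; exists a; split=> //.
by move: ba => /vertex_pt-/(_ (vertex_bound aA)) <-.
Qed.

Lemma additive_comp l m n (h : {omorphism face m -> face n})
  (g : {omorphism face l -> face m}) :
  additive h -> additive g -> additive (omorph_comp h g).
Proof.
move=> ha ga A x; split=> [/ha[y [/ga[a [aA ya]] xy]]|[a [aA /ha[y [ya xy]]]]].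
  by exists a; split=> //; apply/ha; exists y.
by apply/ha; exists y; split=> //; apply/ga; exists a.
Qed.

Lemma additive_eq m n (h g : {omorphism face m -> face n}) :
  additive h -> additive g ->
  (forall a, a <= m -> h (pt m a) = g (pt m a)) -> h = g.
Proof.
move=> ha ga hg; apply: omorph_eq => A; apply: face_eq => x.
split=> [/ha|/ga] [a [aA xa]]; [apply/ga|apply/ha]; exists a; split=> //;
  by move: xa; rewrite hg //; exact: vertex_bound aA.
Qed.

(** Most identities below have the form [h o g = h], with [g] moving a single
    vertex to some face; each amounts to one equality between values of [h]. *)
Lemma absorb m n (h : {omorphism face m -> face n}) (F : nat -> face m) :
  additive h ->
  (forall a, a <= m -> h (F a) = h (pt m a)) ->
  omorph_comp h (@spread m m F) = h.
Proof.
move=> ha hF; apply: omorph_eq => A; apply: face_eq => x.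
split=> [/ha[y [/vertex_spread[a [aA ya]] xy]]|/ha[a [aA]]].
  apply/ha; exists a; split=> //; rewrite -hF; last exact: vertex_bound aA.
  by apply/ha; exists y.
rewrite -hF; last exact: vertex_bound aA.
move=> /ha[y [ya xy]].
by apply/ha; exists y; split=> //; apply/vertex_spread; exists a.
Qed.

(** Invariance under all these operators characterises the simplices of [Ex Y]
    that come from [Y]; see [filled_range]. *)
Definition fill n k : {omorphism face n -> face n} :=
  @spread _ _ (fun a => if a == k then below n k else pt n a).

(** The simplex of [sd n] that lists the vertices [0, ..., i], then the face
    [{0, ..., i}], then the vertices [i + 1, ..., n], extended to unions. *)
Definition insert n i : {omorphism face n.+1 -> face n} :=
  @spread _ _ (fun a => if a == i.+1 then below n i else pt n (unbump i a)).

(** The idempotent through which a simplex factors exactly when its vertex [i +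
    1] is an inserted one; see [lift_insert] and [insert_lift]. *)
Definition reduce n i : {omorphism face n -> face n} :=
  @spread _ _ (fun a => if a == i.+1 then below n i else pt n a).

Definition collapse n l : {omorphism face n -> face n} := face_img (fuse n l).

Definition lift_face n l : {omorphism face n -> face n.+1} :=
  face_img (coface n l).

(** The opposite of [collapse], by which filling is carried over from [i + 1] to
    [i] in [filled_collapse]. *)
Definition raise n l : {omorphism face n -> face n} :=
  @spread _ _ (fun a => if a == l then pt n l.+1 else pt n a).

Lemma vertex_fill n k (A : face n) x :
  has_vertex (fill n k A) x <-> has_vertex A x \/ (has_vertex A k /\ x <= k).
Proof.
split=> [/vertex_spread[a [aA]]|[xA|[kA xk]]].
- case: eqP => [ak|_] xa; [right|left]; subst.
    by split=> //; move: xa => /vertex_below-/(_ (vertex_bound aA)).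
  by move: xa => /vertex_pt-/(_ (vertex_bound aA)) ->.
- apply/vertex_spread; exists x; split=> //; case: eqP => [xk|_].
    by apply/vertex_below; have := vertex_bound xA; lia.
  by apply/vertex_pt => //; exact: vertex_bound xA.
- apply/vertex_spread; exists k; split=> //; rewrite eqxx.
  by apply/vertex_below => //; exact: vertex_bound kA.
Qed.

Lemma vertex_insert n i (A : face n.+1) x : i <= n ->
  has_vertex (insert n i A) x <->
  exists a, has_vertex A a /\ if a == i.+1 then is_true (x <= i) else x =
    unbump i a.
Proof.
move=> ni; split=> [/vertex_spread[a [aA]]|[a [aA]]].
  move=> xa; exists a; split=> //; move: xa; have := vertex_bound aA.
  by case: eqP => _ an; [move/vertex_below; apply|move/vertex_pt; apply;
    rewrite /unbump; lia].
move=> xa; apply/vertex_spread; exists a; split=> //; move: xa;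
  have := vertex_bound aA.
case: eqP => _ an xa; [exact/vertex_below|apply/vertex_pt => //;
  rewrite /unbump; lia].
Qed.

Lemma vertex_reduce n i (A : face n) x :
  has_vertex (reduce n i A) x <->
  exists a, has_vertex A a /\ if a == i.+1 then is_true (x <= i) else x = a.
Proof.
split=> [/vertex_spread[a [aA]]|[a [aA]]].
  move=> xa; exists a; split=> //; move: xa; have := vertex_bound aA.
  by case: eqP => [->|_] an; [move/vertex_below; apply; lia|move/vertex_pt;
    apply].
move=> xa; apply/vertex_spread; exists a; split=> //; move: xa;
  have := vertex_bound aA.
by case: eqP => [->|_] an xa; [apply/vertex_below; lia|apply/vertex_pt].
Qed.

Lemma vertex_collapse n l (A : face n) x :
  has_vertex (collapse n l A) x <->
  exists a, has_vertex A a /\ x = if a == l.+1 then l else a.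
Proof.
by apply: (vertex_img (g := fun a => if a == l.+1 then l else a)) => a;
  rewrite fuse_val.
Qed.

Lemma vertex_lift n l (A : face n) x :
  has_vertex (lift_face n l A) x <-> exists a, has_vertex A a /\ x = bump l a.
Proof. by apply: vertex_img => a; rewrite coface_val. Qed.

Lemma vertex_raise n l (A : face n) x : l < n ->
  has_vertex (raise n l A) x <->
  exists a, has_vertex A a /\ x = if a == l then l.+1 else a.
Proof.
move=> ln; split=> [/vertex_spread[a [aA]]|[a [aA]]].
  move=> xa; exists a; split=> //; move: xa; have := vertex_bound aA.
  by case: eqP => _ an; move/vertex_pt; apply.
move=> ->; apply/vertex_spread; exists a; split=> //; have := vertex_bound aA.
by case: eqP => _ an; apply/vertex_pt.
Qed.

Lemma absorb_fill m n (h : {omorphism face m -> face n}) k : additive h ->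
  (k <= m -> h (below m k) = h (pt m k)) ->
  omorph_comp h (fill m k) = h.
Proof. by move=> ha hk; apply: absorb => // a; case: eqP => [->|]. Qed.

Lemma absorb_reduce m n (h : {omorphism face m -> face n}) i : additive h ->
  (i < m -> h (below m i) = h (pt m i.+1)) ->
  omorph_comp h (reduce m i) = h.
Proof. by move=> ha hk; apply: absorb => // a; case: eqP => [->|]. Qed.

Lemma spread_pt m n (F : nat -> face n) a : a <= m ->
  @spread m n F (pt m a) = F a.
Proof.
move=> am; apply: face_eq => x.
split=> [/vertex_spread[b [/vertex_pt-/(_ am) -> //]]|xa].
by apply/vertex_spread; exists a; split=> //; exact/vertex_pt.
Qed.

Lemma img_pt m n (f : Delta m n) a : face_img f (pt m a) = pt n (f (inord a)).
Proof. by apply: val_inj; rewrite /= imset_set1 inord_val. Qed.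

Lemma absorb_collapse m n (h : {omorphism face m -> face n}) l : additive h ->
  (l < m -> h (pt m l) = h (pt m l.+1)) ->
  omorph_comp h (collapse m l) = h.
Proof.
move=> ha hl; apply: additive_eq => // [|a am].
  exact/additive_comp/additive_img.
rewrite /= img_pt fuse_val inordK //.
by case: eqP am => // -> /hl.
Qed.

Lemma lift_pt n l a : a <= n -> lift_face n l (pt n a) = pt n.+1 (bump l a).
Proof. by move=> an; rewrite /= img_pt coface_val inordK. Qed.

Lemma collapse_pt n l a : a <= n ->
  collapse n l (pt n a) = pt n (if a == l.+1 then l else a).
Proof. by move=> an; rewrite /= img_pt fuse_val inordK. Qed.

Lemma insert_below n i k : i <= n -> k <= i ->
  insert n i (below n.+1 k) = below n k.
Proof.
move=> ni ki; apply: face_eq => x; split.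
  move=> /vertex_insert-/(_ ni)[a [/vertex_below-/(_ (leqW (leq_trans ki ni)))
    ak]].
  by move=> xa; apply/vertex_below; [lia|move: xa; case: eqP; rewrite /unbump;
    lia].
move=> /vertex_below-/(_ (leq_trans ki ni)) xk; apply/vertex_insert => //.
exists x; split; first by apply/vertex_below; lia.
by case: eqP; rewrite /unbump; lia.
Qed.

Lemma insert_below_succ n i : i <= n ->
  insert n i (below n.+1 i.+1) = below n i.
Proof.
move=> ni; apply: face_eq => x; split.
  move=> /vertex_insert-/(_ ni)[a [/vertex_below-/(_ ni) ai xa]].
  by apply/vertex_below; [lia|move: xa; case: eqP; rewrite /unbump; lia].
move=> /vertex_below-/(_ ni) xk; apply/vertex_insert => //.
exists i.+1; rewrite eqxx; split=> //; by apply/vertex_below; lia.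
Qed.

Lemma lift_below n l i : i < l -> i <= n ->
  lift_face n l (below n i) = below n.+1 i.
Proof.
move=> il ni; apply: face_eq => x; split.
  move=> /vertex_lift[a [/vertex_below-/(_ ni) ai ->]].
  by apply/vertex_below; rewrite /bump; lia.
move=> /vertex_below-/(_ (leqW ni)) xi; apply/vertex_lift.
by exists x; split; [exact/vertex_below|rewrite /bump; lia].
Qed.

Lemma reduce_below n i : i < n -> reduce n i (below n i) = below n i.
Proof.
move=> /ltnW ni; apply: face_eq => x; split.
  move=> /vertex_reduce[a [/vertex_below-/(_ ni) ai xa]].
  by apply/vertex_below => //; move: xa; case: eqP => [|_ ->]; lia.
move=> /vertex_below-/(_ ni) xi; apply/vertex_reduce.
by exists x; split; [exact/vertex_below|case: eqP => //; lia].
Qed.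

(** The faces on which [fill k] takes the value [{0, ..., k}], by
    [fill_max_vertex]. *)
Definition max_vertex n (A : face n) k : Prop :=
  has_vertex A k /\ forall y, has_vertex A y -> y <= k.

Lemma fill_max_vertex n (A : face n) k :
  max_vertex A k -> fill n k A = below n k.
Proof.
move=> [kA Ak]; have kn := vertex_bound kA; apply: face_eq => x; split.
  by move=> /vertex_fill[/Ak xk|[_ xk]]; exact/vertex_below.
by move=> /vertex_below-/(_ kn) xk; apply/vertex_fill; right.
Qed.

Lemma max_vertex_pt n k : k <= n -> max_vertex (pt n k) k.
Proof.
by move=> kn; split=> [|y /vertex_pt-/(_ kn) ->] //; exact/vertex_pt.
Qed.

Lemma max_vertex_below n k : k <= n -> max_vertex (below n k) k.
Proof.
by move=> kn; split=> [|y /vertex_below-/(_ kn)] //; exact/vertex_below.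
Qed.

Lemma max_vertex_lift n l k (A : face n) :
  max_vertex A k -> max_vertex (lift_face n l A) (bump l k).
Proof.
move=> [kA Ak]; split; first by apply/vertex_lift; exists k.
by move=> y /vertex_lift[a [/Ak ak ->]]; rewrite leq_bump2.
Qed.

Lemma max_vertex_insert n i k (A : face n.+1) : i <= n ->
  max_vertex A (bump i.+1 k) -> max_vertex (insert n i A) k.
Proof.
move=> ni [kA Ak]; split.
  apply/vertex_insert => //; exists (bump i.+1 k); split=> //.
  by rewrite /bump /unbump; case: eqP; lia.
move=> y /vertex_insert-/(_ ni)[a [/Ak ak]].
by case: eqP; move: ak; rewrite /bump /unbump; lia.
Qed.

Lemma omorph_compE d (P : porderType d) d' (Q : porderType d')
    d'' (S : porderType d'') (g : {omorphism Q -> S}) (f : {omorphism P -> Q})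
      x :
  omorph_comp g f x = g (f x).
Proof. by []. Qed.

Lemma additive_id n : additive (omorph_id (face n)).
Proof.
move=> A x; split=> [xA|[a [aA /= /vertex_pt-/(_ (vertex_bound aA)) -> //]]].
by exists x; split=> //; apply/vertex_pt => //; exact: vertex_bound xA.
Qed.

(** * Identities between the operators *)

Ltac solve_additive := solve [repeat first
  [exact: additive_id | exact: additive_spread | exact: additive_img
  | apply: additive_comp]].

#[local] Hint Extern 0 (additive _) => solve_additive : core.

(** On a face with greatest vertex [k], [fill k] forgets everything else, so
    that [{j}] and [{0, ..., j}] are no longer distinguished after [fill (bump l
    j)]. *)
Lemma fill_lift_fill n l j :
  let h := omorph_comp (fill n.+1 (bump l j)) (lift_face n l) in
  omorph_comp h (fill n j) = h.
Proof.
apply: absorb_fill => // jn; rewrite !omorph_compE.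
by rewrite !fill_max_vertex //; apply: max_vertex_lift;
  first [exact: max_vertex_pt|exact: max_vertex_below].
Qed.

Lemma insert_lift n i : i <= n ->
  omorph_comp (insert n i) (lift_face n i.+1) = omorph_id _.
Proof.
move=> ni; apply: additive_eq => // a an.
rewrite omorph_compE lift_pt // spread_pt; last by rewrite /bump; lia.
by case: eqP; rewrite /bump /unbump /= => ?; [lia|congr pt; lia].
Qed.

Lemma insert_fill_succ n i : i <= n ->
  omorph_comp (insert n i) (fill n.+1 i.+1) = insert n i.
Proof.
move=> ni; apply: absorb_fill => // _.
by rewrite insert_below_succ // spread_pt // eqxx.
Qed.

Lemma fill_insert_fill n i k : i <= n ->
  let h := omorph_comp (fill n k) (insert n i) in
  omorph_comp h (fill n.+1 (bump i.+1 k)) = h.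
Proof.
move=> ni; apply: absorb_fill => // jn; rewrite !omorph_compE.
by rewrite !fill_max_vertex //; apply: max_vertex_insert => //;
  first [exact: max_vertex_pt|exact: max_vertex_below].
Qed.

Lemma insert_lift_reduce n i l : i.+1 < l -> l <= n.+1 ->
  let h := omorph_comp (insert n i) (lift_face n l) in
  omorph_comp h (reduce n i) = h.
Proof.
move=> il ln; apply: absorb_reduce => // ni; rewrite !omorph_compE.
rewrite lift_pt // lift_below 1?ltnW // 1?ltnW // insert_below // 1?ltnW //.
have -> : bump l i.+1 = i.+1 by rewrite /bump; lia.
by rewrite spread_pt ?eqxx // ltnW.
Qed.

Lemma fill_reduce_collapse n i : i < n ->
  let h := omorph_comp (fill n i) (reduce n i) in
  omorph_comp h (collapse n i) = h.
Proof.
move=> ni; apply: absorb_collapse => // _; rewrite !omorph_compE.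
rewrite !(@spread_pt n n (fun a => if a == i.+1 then _ else _)) // 1?ltnW //
  eqxx.
have -> : (i == i.+1) = false by lia.
by rewrite !fill_max_vertex //;
  first [apply: max_vertex_pt|apply: max_vertex_below]; exact: ltnW.
Qed.

Lemma reduce_insert_collapse n i : i < n ->
  let h := omorph_comp (reduce n i) (insert n i) in
  omorph_comp h (collapse n.+1 i.+1) = h.
Proof.
move=> ni; apply: absorb_collapse => // _; rewrite !omorph_compE.
rewrite (@spread_pt n.+1 n) 1?ltnW // eqxx reduce_below //.
rewrite (@spread_pt n.+1 n) //.
have -> : (i.+2 == i.+1) = false by lia.
have -> : unbump i i.+2 = i.+1 by rewrite /unbump; lia.
by rewrite spread_pt // eqxx.
Qed.

Lemma collapse_insert_collapse n i l : i <= n -> l < n -> l != i ->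
  let h := omorph_comp (collapse n l) (insert n i) in
  omorph_comp h (collapse n.+1 (bump i.+1 l)) = h.
Proof.
move=> ni ln li; apply: absorb_collapse => // bn; rewrite !omorph_compE.
rewrite !(@spread_pt n.+1 n) //; last exact: ltnW.
have -> : (bump i.+1 l == i.+1) = false by rewrite /bump; lia.
have -> : ((bump i.+1 l).+1 == i.+1) = false by rewrite /bump; lia.
have -> : unbump i (bump i.+1 l) = l by rewrite /bump /unbump; lia.
have -> : unbump i (bump i.+1 l).+1 = l.+1 by rewrite /bump /unbump; lia.
rewrite !collapse_pt //; last exact: ltnW.
by rewrite eqxx (_ : (l == l.+1) = false) //; lia.
Qed.

Lemma collapse_raise n i : i < n ->
  omorph_comp (collapse n i) (raise n i) = collapse n i.
Proof.
move=> ni; apply: additive_eq => // a an; rewrite ?omorph_compE.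
rewrite spread_pt //; case: eqP => [->|_] //.
rewrite !collapse_pt //; last exact: ltnW.
by rewrite eqxx (_ : (i == i.+1) = false) //; lia.
Qed.

(** Both [{i}] and [{0, ..., i}] are moved to faces with greatest vertex [i +
    1], which [fill (i + 1)] makes equal. *)
Lemma collapse_fill_raise_fill n i : i < n ->
  let h := omorph_comp (collapse n i)
                       (omorph_comp (fill n i.+1) (raise n i)) in
  omorph_comp h (fill n i) = h.
Proof.
move=> ni; apply: absorb_fill => // _; rewrite !omorph_compE.
rewrite (@spread_pt n n (fun a => if a == i then _ else _)) 1?ltnW // eqxx.
rewrite !fill_max_vertex //; first exact: max_vertex_pt.
split; first by apply/vertex_raise => //; exists i; rewrite eqxx; split=> //;
  apply/vertex_below; lia.
move=> y /vertex_raise-/(_ ni)[a [/vertex_below-/(_ (ltnW ni)) ai ->]].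
by case: eqP; lia.
Qed.

Lemma insert_collapse_lift n i : i < n ->
  omorph_comp (insert n i) (omorph_comp (collapse n.+1 i.+1) (lift_face n i.+1))
  = reduce n i.
Proof.
move=> ni; apply: additive_eq => // a an; rewrite ?omorph_compE.
rewrite lift_pt // collapse_pt; last by rewrite /bump; lia.
rewrite !spread_pt //; last by case: eqP; rewrite /bump; lia.
have [->|ai] := eqVneq a i.+1.
  by rewrite (_ : bump i.+1 i.+1 = i.+2) /bump ?eqxx //; lia.
have -> : (bump i.+1 a == i.+2) = false by rewrite /bump; lia.
have -> : (bump i.+1 a == i.+1) = false by rewrite /bump; lia.
by congr pt; rewrite /bump /unbump; lia.
Qed.

Lemma lift_insert n i : i <= n ->
  omorph_comp (lift_face n i.+1) (insert n i) = reduce n.+1 i.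
Proof.
move=> ni; apply: additive_eq => // a an; rewrite ?omorph_compE.
rewrite !spread_pt //; case: eqP => ai; first by rewrite lift_below.
by rewrite lift_pt; [congr pt|]; rewrite /bump /unbump; lia.
Qed.

Lemma lift_collapse n i l : l < n -> l != i ->
  omorph_comp (collapse n.+1 (bump i.+1 l)) (lift_face n i.+1)
  = omorph_comp (lift_face n i.+1) (collapse n l).
Proof.
move=> ln li; apply: additive_eq => // a an; rewrite ?omorph_compE.
rewrite lift_pt // !collapse_pt //; last by rewrite /bump; lia.
rewrite lift_pt; last by case: eqP; lia.
have -> : (bump i.+1 a == (bump i.+1 l).+1) = (a == l.+1).
  by rewrite /bump; apply/eqP/eqP; lia.
by case: eqP.
Qed.

(** The composite of the operators [fill j] for [j < k]. *)
Definition fill_upto n k : {omorphism face n -> face n} :=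
  @spread n n (fun a => if a < k then below n a else pt n a).

Lemma fill_upto_succ n k :
  omorph_comp (fill n k) (fill_upto n k) = fill_upto n k.+1.
Proof.
apply: additive_eq => // a an; rewrite ?omorph_compE.
rewrite !spread_pt //; case: (ltngtP a k) => ak.
- rewrite ltnS (ltnW ak); apply: face_eq => x; split=> [/vertex_fill[//|]|xa].
    by move=> [/vertex_below-/(_ an)]; lia.
  by apply/vertex_fill; left.
- have -> : (a < k.+1) = false by lia.
  rewrite spread_pt //.
  by have -> : (a == k) = false by lia.
- rewrite ak ltnSn spread_pt; last by rewrite -ak.
  by rewrite eqxx.
Qed.

(** * The pairing on the extension of a simplicial set *)

(** The simplicial operators act on [Ex Y] through their face images; this is
    part of an action, here called [pull], of all monotone maps between posets
    of faces. *)

Section Pull.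
Variable Y : sset.

Definition pull m n (w : Ex Y n) (h : {omorphism face m -> face n}) : Ex Y m :=
  hom_comp w (nerve_map h).

Lemma pull_comp l m n (w : Ex Y n) (h : {omorphism face m -> face n})
    (g : {omorphism face l -> face m}) :
  pull (pull w h) g = pull w (omorph_comp h g).
Proof. by apply: hom_eq => k x; congr (w k _); exact: omorph_eq. Qed.

Lemma pull_id n (w : Ex Y n) : pull w (omorph_id _) = w.
Proof. by apply: hom_eq => k x; congr (w k _); exact: omorph_eq. Qed.

Lemma pull_coface n (w : Ex Y n.+1) l :
  act (coface n l) w = pull w (lift_face n l).
Proof. by []. Qed.

Lemma pull_fuse n (w : Ex Y n) l : act (fuse n l) w = pull w (collapse n l).
Proof. by []. Qed.

Definition filled n (w : Ex Y n) k : Prop := pull w (fill n k) = w.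

Definition last_unfilled n (w : Ex Y n) i : Prop :=
  ~ filled w i /\ forall k, i < k -> filled w k.

(** The parents: their vertex [i + 1] is an inserted one. *)
Definition typeI n (w : Ex Y n) i : Prop :=
  [/\ nondeg w, last_unfilled w i, i < n & pull w (reduce n i) = w].

(** The children. *)
Definition typeII n (w : Ex Y n) i : Prop :=
  [/\ nondeg w, last_unfilled w i & ~ (i < n /\ pull w (reduce n i) = w)].

Lemma filled_face n (w : Ex Y n.+1) l j :
  filled w (bump l j) -> filled (pull w (lift_face n l)) j.
Proof.
rewrite /filled => fw.
have -> : pull w (lift_face n l)
    = pull w (omorph_comp (fill n.+1 (bump l j)) (lift_face n l)).
  by rewrite -pull_comp fw.
by rewrite pull_comp fill_lift_fill.
Qed.

Lemma filled_insert_succ n (w : Ex Y n) i :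
  i <= n -> filled (pull w (insert n i)) i.+1.
Proof. by move=> ni; rewrite /filled pull_comp insert_fill_succ. Qed.

Lemma filled_insert n (w : Ex Y n) i k :
  i <= n -> filled w k -> filled (pull w (insert n i)) (bump i.+1 k).
Proof.
rewrite /filled => ni fw.
have -> : pull w (insert n i) = pull w (omorph_comp (fill n k) (insert n i)).
  by rewrite -pull_comp fw.
by rewrite pull_comp fill_insert_fill.
Qed.

Lemma insert_face n (w : Ex Y n) i :
  i <= n -> pull (pull w (insert n i)) (lift_face n i.+1) = w.
Proof. by move=> ni; rewrite pull_comp insert_lift // pull_id. Qed.

Lemma filled_high n (w : Ex Y n) k : n < k -> filled w k.
Proof.
move=> nk; rewrite /filled -[RHS]pull_id; congr pull.
rewrite -[RHS](@absorb_fill _ _ (omorph_id _) k) //; last by lia.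
exact: omorph_eq.
Qed.

Lemma last_unfilled_ex n (w : Ex Y n) :
  (forall k, filled w k) \/ exists i, last_unfilled w i.
Proof.
have [?|/existsNP[k kw]] := pselect (forall k, filled w k); [by left|right].
have ex : exists i, `[< ~ filled w i >] by exists k; apply/asboolP.
have ub i : `[< ~ filled w i >] -> i <= n.
  by move/asboolP => wi; rewrite leqNgt; apply/negP => /(filled_high w).
case: (ex_maxnP ex ub) => i /asboolP iw imax; exists i; split=> // j ij.
by apply: contrapT => /asboolP /imax; lia.
Qed.

Lemma last_unfilled_leq n (w : Ex Y n) i : last_unfilled w i -> i <= n.
Proof. by case=> wi _; rewrite leqNgt; apply/negP => /(filled_high w). Qed.

Lemma last_unfilled_unique n (w : Ex Y n) i j :
  last_unfilled w i -> last_unfilled w j -> i = j.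
Proof.
move=> [wi iw] [wj jw]; have [ij|ji|//] := ltngtP i j.
  by case: wj; exact: iw.
by case: wi; exact: jw.
Qed.

Lemma last_unfilled_insert n (w : Ex Y n) i :
  last_unfilled w i -> last_unfilled (pull w (insert n i)) i.
Proof.
move=> wi; have ni := last_unfilled_leq wi; case: wi => wi iw; split.
  move=> fi; apply: wi; rewrite -(insert_face w ni).
  by apply: filled_face; rewrite (_ : bump _ _ = i) // /bump; lia.
move=> k; rewrite leq_eqVlt => /orP[/eqP <-|ik];
  first exact: filled_insert_succ.
have -> : k = bump i.+1 k.-1 by rewrite /bump; lia.
by apply/filled_insert/iw => //; lia.
Qed.

(** A simplex degenerate along the edge from [i] to [i + 1] is also invariant
    under replacing [i] by [i + 1], so that filling at [i + 1] carries over to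
    [i]. Hence the last unfilled vertex never starts a degenerate edge. *)
Lemma filled_collapse n (w : Ex Y n) i : i < n ->
  pull w (collapse n i) = w -> filled w i.+1 -> filled w i.
Proof.
rewrite /filled => ni cw fw.
(* The composite in [wE] fixes [w] and takes the same value at [{i}] and at
   [{0, ..., i}]. *)
have rw : pull w (raise n i) = w by rewrite -cw pull_comp collapse_raise.
have wE : w = pull w (omorph_comp (collapse n i)
                       (omorph_comp (fill n i.+1) (raise n i))).
  by rewrite -!pull_comp cw fw rw.
by rewrite {1}wE pull_comp collapse_fill_raise_fill // -wE.
Qed.

(** A degeneracy of the parent along the edge from [l] to [l + 1] is excluded as
    follows: for [l = i] by [filled_collapse]; for [l = i + 1] because it would
    make [w] itself a parent; otherwise because it restricts to a degeneracy of
    [w]. *)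
Lemma insert_nondeg n (w : Ex Y n) i :
  typeII w i -> nondeg (pull w (insert n i)).
Proof.
move=> [wn wi nI]; have ni := last_unfilled_leq wi.
have [Pi iP] := last_unfilled_insert wi.
move=> l ln; rewrite pull_fuse => cP.
have [lE|lNi] := eqVneq l i.
  by subst l; apply: Pi; apply: filled_collapse cP _ => //;
    exact: filled_insert_succ.
have [lE|lNSi] := eqVneq l i.+1.
  subst l; apply: nI; split=> //.
  by rewrite -insert_collapse_lift // -!pull_comp cP insert_face.
have lb : l = bump i.+1 (unbump i.+1 l) by rewrite unbumpKcond (negPf lNSi)
  add0n.
apply: (wn (unbump i.+1 l)); first by rewrite /unbump; lia.
rewrite pull_fuse -[in LHS](insert_face w ni) pull_comp -lift_collapse.
- by rewrite -lb -pull_comp cP insert_face.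
- by rewrite /unbump; lia.
- by rewrite /unbump; lia.
Qed.

Lemma insert_typeI n (w : Ex Y n) i :
  typeII w i -> typeI (pull w (insert n i)) i.
Proof.
move=> w2; have [_ wi _] := w2; have ni := last_unfilled_leq wi.
split=> //; [exact: insert_nondeg|exact: last_unfilled_insert|].
by rewrite -lift_insert // -pull_comp insert_face.
Qed.

(** Conversely to [insert_typeI], a parent is the parent of its face opposite to
    the vertex [i + 1].  That face is a child: a degeneracy of it, or its
    invariance under [reduce i], would make the parent degenerate. *)
Lemma typeI_face n (u : Ex Y n.+1) i : typeI u i ->
  typeII (pull u (lift_face n i.+1)) i /\
  u = pull (pull u (lift_face n i.+1)) (insert n i).
Proof.
move=> [un [ui iu]]; rewrite ltnS => ni ru.
have uE : u = pull (pull u (lift_face n i.+1)) (insert n i).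
  by rewrite pull_comp lift_insert.
split=> //; set w := pull u _ in uE *.
have wi : ~ filled w i.
  move=> fw; apply: ui; rewrite uE; have := filled_insert ni fw.
  by rewrite (_ : bump i.+1 i = i) // /bump; lia.
have iw k : i < k -> filled w k.
  by move=> ik; apply/filled_face/iu; rewrite /bump; lia.
split=> // [l ln|[ni' rw]].
  rewrite pull_fuse => cw; have [lE|lNi] := eqVneq l i.
    by subst l; apply: wi; apply: filled_collapse cw _ => //; exact: iw.
  apply: (un (bump i.+1 l)); first by rewrite /bump; lia.
  rewrite pull_fuse uE.
  rewrite -[in LHS]cw (pull_comp w) pull_comp collapse_insert_collapse //.
  by rewrite -pull_comp cw.
apply: (un i.+1); rewrite // pull_fuse uE.
rewrite -[in LHS]rw (pull_comp w) pull_comp reduce_insert_collapse //.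
by rewrite -pull_comp rw.
Qed.

Lemma typeE n (w : Ex Y n) : nondeg w ->
  [\/ forall k, filled w k, exists i, typeI w i | exists i, typeII w i].
Proof.
move=> wn; have [?|[i wi]] := last_unfilled_ex w; first exact: Or31.
have [[ni rw]|nI] := pselect (i < n /\ pull w (reduce n i) = w).
  by apply: Or32; exists i.
by apply: Or33; exists i.
Qed.

(** The face opposite to [l > i + 1] is invariant under [reduce i], and being
    filled at [i] would make it degenerate along the edge from [i] to [i + 1].
    In the face opposite to [l <= i], all vertices from [i] on are filled. *)
Lemma insert_faces n (w : Ex Y n) i l : typeII w i -> l <= n.+1 -> l != i.+1 ->
  let y := pull (pull w (insert n i)) (lift_face n l) in
  nondeg y ->
  [\/ forall k, filled y k, exists j, typeI y j
    | exists2 j, j < i & typeII y j].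
Proof.
move=> w2; have [_ wi _] := w2; have ni := last_unfilled_leq wi.
have [Pi iP] := last_unfilled_insert wi.
move=> ln li y yn; have [il|il] := leqP l i.
  have [||[j yj]] := typeE yn; [exact: Or31|exact: Or32|].
  apply: Or33; exists j => //; rewrite ltnNge; apply/negP => ij.
  by case: yj => _ [yj _] _; apply/yj/filled_face/iP; rewrite /bump; lia.
have {}il : i.+1 < l by lia.
have ry : pull y (reduce n i) = y.
  by rewrite /y (pull_comp w) pull_comp insert_lift_reduce.
apply: Or32; exists i; split=> //; last by lia.
split=> [fy|k ik]; last by apply/filled_face/iP; rewrite /bump; lia.
have ni' : i < n by lia.
apply: (yn i ni'); rewrite pull_fuse.
have -> : y = pull y (omorph_comp (fill n i) (reduce n i)).
  by rewrite -pull_comp fy ry.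
by rewrite pull_comp fill_reduce_collapse.
Qed.

Lemma below_homo n :
  {homo (fun a : 'I_n.+1 => below n a) : a b / (a <= b)%O}.
Proof.
move=> a b; rewrite leEord => ab; apply/fintype.subsetP => x.
by rewrite !finset.inE => xa; exact: leq_trans ab.
Qed.

(** The only monotone section of the last-vertex map. *)
Definition initial n : {omorphism 'I_n.+1 -> face n} :=
  omorph_of (@below_homo n).

Lemma max_initial n : omorph_comp (@face_max n) (initial n) = omorph_id _.
Proof.
apply: omorph_eq => a; apply/eqP; rewrite omorph_compE eq_le; apply/andP; split.
  by have := face_max_mem (below n a); rewrite finset.inE.
by apply: face_max_ub; rewrite finset.inE.
Qed.

Lemma initial_max n : omorph_comp (initial n) (@face_max n) = fill_upto n n.+1.
Proof.
apply: omorph_eq => A; apply: face_eq => x.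
split=> [/vertex_below-/(_ (leq_ord _)) xA|/vertex_spread[a [aA]]].
  apply/vertex_spread; exists (face_max A); split.
    by exists (face_max A) => //; exact: face_max_mem.
  by rewrite ltn_ord; apply/vertex_below => //; exact: leq_ord.
have an := vertex_bound aA; rewrite ltnS an => /vertex_below-/(_ an) xa.
apply/vertex_below; first exact: leq_ord.
case: aA => b bA ba; apply: leq_trans xa _; rewrite -ba.
by have := face_max_ub bA; rewrite leEord.
Qed.

Lemma pull_fill_upto n (w : Ex Y n) k :
  (forall k, filled w k) -> pull w (fill_upto n k) = w.
Proof.
move=> fw; elim: k => [|k IH].
  rewrite -[RHS]pull_id; congr pull; apply: additive_eq => // a an.
  by rewrite spread_pt.
by rewrite -fill_upto_succ -pull_comp fw.
Qed.

(** Filling at every vertex replaces each face [A] by [{0, ..., max A}], so it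
    factors the simplex through the last-vertex map. *)
Lemma filled_range n (w : Ex Y n) :
  (forall k, filled w k) <-> range (@Ex_unit Y n) w.
Proof.
split=> [fw|[y _ <-] k].
  exists (w n (initial n)) => //.
  rewrite -[RHS](pull_fill_upto n.+1 fw) -initial_max.
  apply: hom_eq => m x /=; rewrite -app_act; congr (w m _); exact: omorph_eq.
apply: hom_eq => m x /=; congr (act _ y); apply: omorph_eq => a /=.
set A := x a; apply/eqP; rewrite eq_le; apply/andP; split; last first.
  apply/face_max_homo/fintype.subsetP => b bA.
  have : has_vertex (fill n k A) b by apply/vertex_fill; left; exists b.
  by move=> [c cA /ord_inj <-].
have /vertex_fill : has_vertex (fill n k A) (face_max (fill n k A)).
  by exists (face_max (fill n k A)) => //; exact: face_max_mem.
move=> [[b bA /ord_inj <-]|[[b bA bk] mk]]; first exact: face_max_ub.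
by apply: le_trans (face_max_ub bA); rewrite leEord bk.
Qed.

Lemma Ex_unit_inj n : injective (@Ex_unit Y n).
Proof.
move=> x y /(congr1 (fun h : Ex Y n => h n (initial n))) /=.
by rewrite max_initial !act_id.
Qed.

End Pull.

(** * Sequential colimits of monomorphisms *)

Section ColimitOfMonos.
Variables (X : nat -> sset) (j : forall k, hom (X k) (X k.+1)).
Hypothesis j_inj : forall k n, injective (j k n).

(** The representative of lowest level. It is unchanged by a step of the colimit
    because the transition maps are injective, so it is an invariant of classes.
    *)
Fixpoint normal_form n k : X k n -> {k : nat & X k n} :=
  match k with
  | 0 => fun x => existT (fun k => X k n) 0 x
  | k'.+1 => fun x =>
    match pselect (range (j k' n) x) with
    | left xj => normal_form (projT1 (cid2 xj))
    | right _ => existT (fun k => X k n) k'.+1 x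
    end
  end.

Lemma normal_form_step n k (x : X k n) : normal_form (j k n x) = normal_form x.
Proof.
rewrite /=; case: pselect => [xj|]; last by case; exists x.
by case: (cid2 xj) => /= y _ /j_inj ->.
Qed.

Lemma normal_form_new n k (x : X k.+1 n) :
  ~ range (j k n) x -> normal_form x = existT (fun k => X k n) k.+1 x.
Proof. by rewrite /=; case: pselect. Qed.

Lemma normal_form_leq n k (x : X k n) : projT1 (normal_form x) <= k.
Proof.
elim: k x => //= k IH x; case: pselect => // xj; exact: leqW (IH _).
Qed.

Lemma normal_form_rel n (p q : {k : nat & X k n}) :
  colim_rel j p q -> normal_form (projT2 p) = normal_form (projT2 q).
Proof.
elim=> {p q} [_ _ [k x]|//|p q _ -> //|p q r _ -> _ -> //].
by rewrite [in RHS]normal_form_step.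
Qed.

Lemma colim_in_eq n k l (x : X k n) (y : X l n) :
  colim_in j k n x = colim_in j l n y -> normal_form x = normal_form y.
Proof. by move=> /colim_class_eq /normal_form_rel. Qed.

Lemma colim_in_step n k (x : X k n) :
  colim_in j k.+1 n (j k n x) = colim_in j k n x.
Proof.
by rewrite -[RHS](congr1 (fun h : hom _ _ => h n x) (colim_in_compat j k)).
Qed.

Lemma colim_in_inj k n : injective (colim_in j k n).
Proof.
elim: k => [|k IH] x y /[dup] xy /colim_in_eq.
  exact: existT_inj.
have [[x' _ xE]|xn] := pselect (range (j k n) x);
  have [[y' _ yE]|yn] := pselect (range (j k n) y).
- move=> _; rewrite -xE -yE; congr (j k n _); apply: IH.
  by rewrite -(colim_in_step x') -(colim_in_step y') xE yE.
- rewrite (normal_form_new yn) -xE normal_form_step => /(congr1 (@projT1 _ _))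
  /= E.
  by have := normal_form_leq x'; rewrite E ltnn.
- rewrite (normal_form_new xn) -yE normal_form_step => /(congr1 (@projT1 _ _))
  /= E.
  by have := normal_form_leq y'; rewrite -E ltnn.
- rewrite !normal_form_new //; exact: existT_inj.
Qed.

Lemma colim_in_new_eq n k l (x : X k.+1 n) (y : X l.+1 n) :
  ~ range (j k n) x -> ~ range (j l n) y ->
  colim_in j k.+1 n x = colim_in j l.+1 n y ->
  existT (fun k => X k.+1 n) k x = existT _ l y.
Proof.
move=> xn yn /colim_in_eq; rewrite !normal_form_new // => E.
have [kl] := congr1 (@projT1 _ _) E; rewrite -kl in y yn E *.
by rewrite (existT_inj E).
Qed.

Lemma colim_in_new n k (x : X k.+1 n) :
  ~ range (j k n) x -> ~ range (colim_in j 0 n) (colim_in j k.+1 n x).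
Proof.
by move=> xn [y _ /colim_in_eq /esym];
  rewrite normal_form_new // => /(congr1 (@projT1 _ _)).
Qed.

Lemma colim_cover n (c : colim j n) : range (colim_in j 0 n) c \/
  exists k (x : X k.+1 n), ~ range (j k n) x /\ c = colim_in j k.+1 n x.
Proof.
have [[k x] ->] := colim_classP c;
  change (colim_class _ _) with (colim_in j k n x).
elim: k x => [|k IH] x; first by left; exists x.
have [[y _ <-]|xn] := pselect (range (j k n) x); last by right; exists k, x.
by rewrite colim_in_step.
Qed.

End ColimitOfMonos.

Lemma nondeg_mono (A B : sset) (f : hom A B) n (x : A n) :
  (forall n, injective (f n)) -> nondeg (f n x) <-> nondeg x.
Proof.
move=> fi; split=> xn l ln; first by move=> xl; apply: (xn l ln);
  rewrite -app_act xl.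
by rewrite -app_act => /fi; exact: xn.
Qed.

(** * The pairing on the colimit *)

Section ExInfty.
Variable X : sset.
Local Notation E := (Ex_iter X).

Definition into k : hom (E k) (Ex_infty X) := colim_in (Ex_iter_unit X) k.

Lemma unit_inj k n : injective (Ex_iter_unit X k n).
Proof. exact: Ex_unit_inj. Qed.

Lemma into_inj k n : injective (into k n).
Proof. exact: colim_in_inj unit_inj k n. Qed.

Lemma into_eq n k l (x : Ex (E k) n) (y : Ex (E l) n) :
  ~ (forall i, filled x i) -> ~ (forall i, filled y i) ->
  into k.+1 n x = into l.+1 n y ->
  existT (fun k => Ex (E k) n) k x = existT _ l y.
Proof.
move=> xn yn; apply: (colim_in_new_eq unit_inj).
  by move/(filled_range x).
by move/(filled_range y).
Qed.

(** The couples, indexed by their children. *)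
Record cell := Cell {
  cell_level : nat;
  cell_dim : nat;
  cell_simplex : Ex (E cell_level) cell_dim;
  cell_vertex : nat;
  cellP : typeII cell_simplex cell_vertex }.

Definition cell_horn (c : cell) : 'I_(cell_dim c).+2 :=
  inord (cell_vertex c).+1.

Definition cell_parent (c : cell) : Ex_infty X (cell_dim c).+1 :=
  into (cell_level c).+1 _ (pull (cell_simplex c) (insert _ (cell_vertex c))).

Definition cell_rank (c : cell) : nat :=
  2 ^ (cell_dim c + cell_level c).+1 + cell_vertex c.

Lemma cell_vertex_leq c : cell_vertex c <= cell_dim c.
Proof. by case: (cellP c) => _ /last_unfilled_leq. Qed.

Lemma cell_child c :
  child cell_horn cell_parent c = into (cell_level c).+1 _ (cell_simplex c).
Proof.
have ci := cell_vertex_leq c.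
rewrite /child /cell_horn /cell_parent inordK ?ltnS // -app_act pull_coface.
by rewrite insert_face.
Qed.

Lemma cell_eq (c d : cell) :
  existT (fun k => {n & Ex (E k) n}) (cell_level c) (existT _ _ (cell_simplex
    c))
  = existT _ (cell_level d) (existT _ _ (cell_simplex d)) -> c = d.
Proof.
case: c d => [k n x i xi] [l m y j yj] /= kl.
have klE : k = l := congr1 (@projT1 _ _) kl.
case: l / klE in y yj kl *; have {}kl := existT_inj kl.
have nm : n = m := congr1 (@projT1 _ _) kl.
case: m / nm in y yj kl *; have {}kl := existT_inj kl.
case: y / kl in yj *.
have ij : i = j by case: xi yj => _ xi _ [_ xj _];
  exact: last_unfilled_unique xi xj.
by case: j / ij in yj *; rewrite (Prop_irrelevance xi yj).
Qed.

Lemma typeII_not_filled Y n (w : Ex Y n) i : typeII w i -> ~ forall k,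
  filled w k.
Proof. by case=> _ [wi _] _ fw; apply: wi. Qed.

Lemma typeI_not_filled Y n (w : Ex Y n) i : typeI w i -> ~ forall k, filled w k.
Proof. by case=> _ [wi _] _ _ fw; apply: wi. Qed.

Lemma cell_child_inj c d :
  existT (Ex_infty X) _ (child cell_horn cell_parent c)
  = existT (Ex_infty X) _ (child cell_horn cell_parent d) -> c = d.
Proof.
rewrite !cell_child => cd; apply: cell_eq.
case: c d cd => [k n x i xi] [l m y j yj] /= cd.
have nm : n = m := congr1 (@projT1 _ _) cd.
case: m / nm in y yj cd *.
have := into_eq (typeII_not_filled xi) (typeII_not_filled yj) (existT_inj cd).
exact: (@existT_map (fun k => Ex (E k) n) (fun k => {n & Ex (E k) n})
  (fun k => existT (fun n => Ex (E k) n) n)).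
Qed.

Lemma cell_parent_inj c d :
  existT (Ex_infty X) _ (cell_parent c) = existT (Ex_infty X) _ (cell_parent d)
    ->
  c = d.
Proof.
move=> cd; apply: cell_eq.
case: c d cd => [k n x i xi] [l m y j yj]; rewrite /cell_parent /= => cd.
have [nm] : n.+1 = m.+1 := congr1 (@projT1 _ _) cd.
case: m / nm in y yj cd *.
have xI := insert_typeI xi; have yI := insert_typeI yj.
have kl := into_eq (typeI_not_filled xI) (typeI_not_filled yI) (existT_inj cd).
have klE : k = l := congr1 (@projT1 _ _) kl.
case: l / klE in y yj yI kl cd *; have {}kl := existT_inj kl.
have ij : i = j.
  case: xI yI => _ xI _ _ [_ yI _ _]; rewrite -kl in yI.
  exact: last_unfilled_unique xI yI.
have ni : i <= n by case: xi => _ /last_unfilled_leq.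
by rewrite -[x](insert_face _ ni) kl -ij insert_face.
Qed.

Lemma cell_child_parent c d :
  existT (Ex_infty X) _ (child cell_horn cell_parent c)
  <> existT (Ex_infty X) _ (cell_parent d).
Proof.
rewrite cell_child; case: c d => [k n x i xi] [l m y j yj].
rewrite /cell_parent /= => cd.
have nm : n = m.+1 := congr1 (@projT1 _ _) cd.
move: x xi cd; rewrite nm => x xi cd.
have yI := insert_typeI yj.
have kl := into_eq (typeII_not_filled xi) (typeI_not_filled yI) (existT_inj cd).
have klE : k = l := congr1 (@projT1 _ _) kl.
case: l / klE in y yj yI kl cd *; have {}kl := existT_inj kl.
case: xi yI => _ xi nI [_ yI jm ry]; rewrite -kl in yI ry.
by apply: nI; rewrite (last_unfilled_unique xi yI).
Qed.

Local Notation generated :=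
  (@generated _ _ (Ex_infty_unit X) cell cell_dim cell_parent cell_rank).

Lemma generated_typeII k n (y : Ex (E k) n) i : typeII y i ->
  generated (Some (2 ^ (n + k).+1 + i).+1) (into k.+1 n y).
Proof.
move=> yi; right; exists (Cell yi), (coface n i.+1); split; first exact: leqnn.
by rewrite /cell_parent -app_act pull_coface insert_face //;
  exact: cell_vertex_leq (Cell yi).
Qed.

Lemma rank_bound n k i : i <= n -> 2 ^ (n + k).+1 + i < 2 ^ (n + k).+2.
Proof.
move=> ni; rewrite [in ltnRHS]expnS mul2n -addnn ltn_add2l.
by apply: leq_ltn_trans (ltn_expl _ (ltnSn 1)); lia.
Qed.

(** The child of a parent of dimension [n] has dimension [n - 1], whence one
    factor of two less than in [generated_typeII]. *)
Lemma generated_typeI k n (y : Ex (E k) n) i : typeI y i ->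
  generated (Some (2 ^ (n + k).+1)) (into k.+1 n y).
Proof.
case: n y => [|n] y yi; first by case: yi.
have [wi wE] := typeI_face yi.
right; exists (Cell wi), (omorph_id _); rewrite act_id; split; last first.
  by rewrite /cell_parent /= -wE.
exact: rank_bound (cell_vertex_leq (Cell wi)).
Qed.

(** The nondegenerate root is a child, a parent, or comes from a lower level,
    and dimension plus level does not grow. *)
Lemma generated_into k n (x : E k n) :
  generated (Some (2 ^ (n + k).+1)) (into k n x).
Proof.
elim: k n x => [|k IH] n x; first by left; exists x.
have [m [y [f [mn yn ->]]]] := nondeg_root x.
rewrite app_act; apply: generated_act.
apply: (@generated_le _ _ _ _ _ _ _ (Some (2 ^ (m + k.+1).+1))).
  by rewrite /= leq_exp2l // ltnS leq_add2r.
have [/filled_range[z _ <-]|[i yi]|[i yi]] := typeE yn.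
- rewrite /into colim_in_step; apply: generated_le (IH _ z).
  by rewrite /= leq_exp2l // ltnS leq_add2l.
- apply: generated_le (generated_typeI yi).
  by rewrite /= leq_exp2l // ltnS leq_add2l.
- apply: generated_le (generated_typeII yi); rewrite addnS /=.
  by apply: rank_bound; case: yi => _ /last_unfilled_leq.
Qed.

(** Each face other than the child is degenerate, comes from the previous level,
    is a parent, or is a child with a smaller last unfilled vertex; in the first
    three cases dimension plus level drops for the cell containing it. *)
Lemma cell_faces c l : l <= (cell_dim c).+1 -> l != cell_horn c ->
  generated (Some (cell_rank c)) (act (coface _ l) (cell_parent c)).
Proof.
have := cell_vertex_leq c; case: c => [k n x i xi].
rewrite [cell_dim _]/= [cell_vertex _]/= => ni ln.
rewrite /cell_horn inordK ?ltnS // [cell_vertex _]/= => li.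
have -> : act (coface n l) (cell_parent (Cell xi))
    = into k.+1 n (pull (pull x (insert n i)) (lift_face n l)).
  by rewrite /cell_parent -app_act.
rewrite [cell_rank _](_ : _ = 2 ^ (n + k).+1 + i) //.
have low a : a <= 2 ^ (n + k).+1 -> rank_le (Some a) (Some (2 ^ (n + k).+1 +
  i)).
  by move=> h; rewrite /=; lia.
set y := pull _ (lift_face n l).
have [yn|/degenerate_factor[m [z [f [mn ->]]]]] := pselect (nondeg y);
  last first.
  rewrite app_act; apply: generated_act;
    apply: generated_le (@generated_into k.+1 m z).
  by apply: low; rewrite leq_exp2l //; lia.
have := insert_faces xi ln li yn; cbv zeta; rewrite -/y.
clearbody y => -[/filled_range[z _ <-]|[j yj]|[j ji yj]].
- rewrite /into colim_in_step; apply: generated_le (generated_into z).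
  exact: low.
- by apply: generated_le (generated_typeI yj); apply: low.
- by apply: generated_le (generated_typeII yj); rewrite /= ltn_add2l.
Qed.

End ExInfty.

Theorem corollary3p11 (X : sset) : strong_anodyne (Ex_infty_unit X).
Proof.
apply: (@ranked_strong_anodyne _ _ _ _ (cell X) (@cell_dim X) (@cell_horn X)
  (@cell_parent X) (@cell_rank X)).
- by apply/monicP; exact: (@into_inj X 0).
- move=> c; apply/nondeg_mono; first exact: into_inj.
  exact: insert_nondeg (cellP c).
- move=> c; rewrite cell_child; apply/nondeg_mono; first exact: into_inj.
  by case: (cellP c).
- move=> c; rewrite cell_child; apply: colim_in_new; first exact: unit_inj.
  by move/filled_range; exact: typeII_not_filled (cellP c).
- exact: cell_parent_inj.
- exact: cell_child_inj.
- exact: cell_child_parent.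
- move=> n x xn; have [?|[k [y [yr xE]]]] := colim_cover x; first exact: Or31.
  have yn : nondeg y by move: xn; rewrite xE => /nondeg_mono; apply;
    exact: into_inj.
  rewrite xE; have [/filled_range //|[i yi]|[i yi]] := typeE yn.
  + apply: Or33; case: n y yi {x xn yn yr xE} => [|n] y yi; first by case: yi.
    have [wi wE] := typeI_face yi; exists (Cell wi).
    by rewrite /cell_parent [cell_level _]/= [cell_simplex _]/= -wE.
  + by apply: Or32; exists (Cell yi); rewrite cell_child.
- exact: cell_faces.
Qed.
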